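(* Let $M,r\colon\mathbb{R}_+\to(0,\infty)$ be non-decreasing functions and assume that $M$ is continuous and such that $M(s)=O(e^{\alpha s})$ as $s\to\infty$ for some $\alpha>0$. Let $$\Omega_M=\left\{\lambda\in\mathbb{C}:\operatorname{Re}\lambda>-\frac{1}{M(|\operatorname{Im}\lambda|)}\right\},\qquad M_{\mathrm{log}}(s)=M(s)\big(\log(1+s)+\log(1+M(s))\big),\quad s\ge0.$$ (1) Suppose that $$|f(t)|=O\big(r(t)^{-1}\big),\quad t\to\infty,$$ for every bounded Lipschitz continuous function $f\colon\mathbb{R}_+\to\mathbb{C}$ whose Laplace transform $\widehat f$ extends analytically to the region $\Omega_M$ and satisfies $$\sup_{\lambda\in\Omega_M}\frac{|\widehat f(\lambda)|}{M(|\operatorname{Im}\lambda|)}<\infty.$$ Then $$r(t)=O\big(M_{\mathrm{log}}^{-1}(t)\big),\quad t\to\infty.$$ (2) Assume in addition that there are $b,\beta>0$ such that $M(s)\ge bs^\beta$ for all sufficiently large $s\ge0$, but suppose only that $|f(t)|=O(r(t)^{-1})$ as $t\to\infty$ holds for all bounded Lipschitz continuous functions $f\colon\mathbb{R}_+\to\mathbb{C}$ such that $f'$ is uniformly continuous and the Laplace transform of $f$ extends analytically to the region $\Omega_M$ and satisfies $$\sup_{\lambda\in\Omega_M}\frac{|\lambda\widehat f(\lambda)|}{M(|\operatorname{Im}\lambda|)}<\infty.$$ Then $$r(t)=O\big(M_{\mathrm{log}}^{-1}(ct)\big),\quad t\to\infty,$$ where $c=1+\beta^{-1}$.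
   Context: $\mathbb{R}_+=[0,\infty)$. For a bounded continuous $f\colon\mathbb{R}_+\to\mathbb{C}$ the Laplace transform is $\widehat f(\lambda)=\int_0^\infty e^{-\lambda t}f(t)\,\mathrm{d}t$ for $\operatorname{Re}\lambda>0$; its analytic extension to $\Omega_M$ (which contains the open right half-plane) is denoted by the same symbol. $r(t)^{-1}$ denotes the reciprocal $1/r(t)$, whereas $M_{\mathrm{log}}^{-1}$ denotes the inverse function of the continuous strictly increasing function $M_{\mathrm{log}}$, which is defined for all sufficiently large arguments. ''$f'$ is uniformly continuous'' means that $f$ is differentiable with uniformly continuous derivative. *)

(* Defs.v *)
From Stdlib Require Import Reals Lra.
From Coquelicot Require Import Coquelicot.

Open Scope R_scope.

(* A function on R_+ = [0,oo) is represented by a function on R of which only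
   the values at t >= 0 are ever used. *)
Definition Rnonneg (t : R) : Prop := 0 <= t.

Definition nondecreasing_on_Rplus (u : R -> R) : Prop :=
  forall s t, 0 <= s -> s <= t -> u s <= u t.

Definition bigO_infty (u v : R -> R) : Prop :=
  exists K T : R, forall t, T <= t -> Rabs (u t) <= K * Rabs (v t).

Definition Omega (M : R -> R) (z : C) : Prop :=
  Re z > - (1 / M (Rabs (Im z))).

Definition Mlog (M : R -> R) (s : R) : R :=
  M s * (ln (1 + s) + ln (1 + M s)).

(* The unique s >= 0 with Mlog M s = t.  It exists for t >= Mlog M 0 (see
   [Mlog_inv_spec]); for other t the value is irrelevant. *)
Definition Mlog_inv (M : R -> R) (t : R) : R :=
  iota (fun s : R => 0 <= s /\ Mlog M s = t).

Definition bounded_on_Rplus (f : R -> C) : Prop :=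
  exists K : R, forall t, 0 <= t -> Cmod (f t) <= K.

Definition lipschitz_on_Rplus (f : R -> C) : Prop :=
  exists L : R, forall s t, 0 <= s -> 0 <= t ->
    Cmod (f s - f t)%C <= L * Rabs (s - t).

Definition uniformly_continuous_on_Rplus (g : R -> C) : Prop :=
  forall eps : R, 0 < eps -> exists delta : R, 0 < delta /\
    forall s t, 0 <= s -> 0 <= t -> Rabs (s - t) < delta ->
      Cmod (g s - g t)%C < eps.

(* [is_derive] with the neighbourhood filter restricted to [0,oo): the
   two-sided derivative for t > 0, the right derivative at t = 0. *)
Definition is_derive_on_Rplus (f g : R -> C) : Prop :=
  forall t, 0 <= t ->
    filterdiff (U := R_NormedModule) (V := C_R_NormedModule)
      f (within Rnonneg (locally t)) (fun h : R => scal h (g t)).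

Definition has_uniformly_continuous_derivative (f : R -> C) : Prop :=
  exists g : R -> C, is_derive_on_Rplus f g /\ uniformly_continuous_on_Rplus g.

Definition Cexp (z : C) : C :=
  (exp (Re z) * cos (Im z), exp (Re z) * sin (Im z)).

Definition laplace (f : R -> C) (z : C) : C :=
  RInt_gen (V := C_R_CompleteNormedModule)
    (fun t : R => (Cexp (- (z * RtoC t)) * f t)%C)
    (at_point 0) (Rbar_locally p_infty).

Definition analytic_on (D : C -> Prop) (F : C -> C) : Prop :=
  forall z, D z -> ex_derive (K := C_AbsRing) (V := C_NormedModule) F z.

Definition laplace_extends_to (M : R -> R) (f : R -> C) (F : C -> C) : Prop :=
  analytic_on (Omega M) F /\ forall z : C, 0 < Re z -> F z = laplace f z.

Lemma Mlog_strict (M : R -> R) :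
  (forall s, 0 <= s -> 0 < M s) ->
  nondecreasing_on_Rplus M ->
  forall s t, 0 <= s -> s < t -> Mlog M s < Mlog M t.
Proof.
intros M_pos M_incr s t.
intros Hs Hst. unfold Mlog.
assert (H1 := M_pos s Hs).
assert (H2 := M_incr s t Hs (Rlt_le _ _ Hst)).
assert (H3 : ln (1 + s) < ln (1 + t)) by (apply ln_increasing; lra).
assert (H4 : ln (1 + M s) <= ln (1 + M t)).
{ destruct H2 as [H2|H2]; [left; apply ln_increasing; lra | rewrite H2; lra]. }
assert (H5 : 0 <= ln (1 + s)).
{ rewrite <- ln_1; destruct Hs as [Hs|<-];
  [left; apply ln_increasing; lra | rewrite Rplus_0_r; lra]. }
assert (H6 : 0 < ln (1 + M s)) by (rewrite <- ln_1; apply ln_increasing; lra).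
apply Rle_lt_trans with (M t * (ln (1 + s) + ln (1 + M s))).
- apply Rmult_le_compat_r; lra.
- apply Rmult_lt_compat_l; lra.
Qed.

Lemma M_Rabs_continuous (M : R -> R) :
  continuous_on Rnonneg M ->
  forall x, continuous (fun y => M (Rabs y)) x.
Proof.
intros M_cont x.
apply (filterlim_comp _ _ _ Rabs M (locally x) (within Rnonneg (locally (Rabs x)))).
- intros P HP.
  generalize (continuous_Rabs x _ HP); unfold filtermap.
  apply filter_imp; intros y Hy; apply Hy, Rabs_pos.
- apply M_cont, Rabs_pos.
Qed.

Lemma Mlog_Rabs_continuous (M : R -> R) :
  (forall s, 0 <= s -> 0 < M s) ->
  continuous_on Rnonneg M ->
  forall x, continuous (fun y => Mlog M (Rabs y)) x.
Proof.
intros M_pos M_cont x.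
assert (H1 := M_Rabs_continuous M M_cont x).
assert (Hp := M_pos _ (Rabs_pos x)).
assert (Ha := Rabs_pos x).
assert (ln_c : forall y, 0 < y -> continuous ln y).
{ intros y Hy; apply (ex_derive_continuous (K := R_AbsRing) (V := R_NormedModule)).
  exists (/ y); apply is_derive_ln, Hy. }
unfold Mlog.
apply (continuous_mult (K := R_AbsRing) (fun y => M (Rabs y))
         (fun y => ln (1 + Rabs y) + ln (1 + M (Rabs y)))); [exact H1|].
apply (continuous_plus (V := R_NormedModule)
         (fun y => ln (1 + Rabs y)) (fun y => ln (1 + M (Rabs y)))).
- apply (continuous_comp (fun y => 1 + Rabs y) ln); [|apply ln_c; lra].
  apply (continuous_plus (V := R_NormedModule) (fun _ => 1) Rabs);
    [apply continuous_const | apply continuous_Rabs].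
- apply (continuous_comp (fun y => 1 + M (Rabs y)) ln); [|apply ln_c; lra].
  apply (continuous_plus (V := R_NormedModule) (fun _ => 1) (fun y => M (Rabs y)));
    [apply continuous_const | exact H1].
Qed.

Lemma Mlog_unbounded (M : R -> R) :
  (forall s, 0 <= s -> 0 < M s) ->
  nondecreasing_on_Rplus M ->
  forall t, exists s, 0 <= s /\ t <= Mlog M s.
Proof.
intros M_pos M_incr t.
assert (H0 := M_pos 0 (Rle_refl _)).
exists (exp (Rabs t / M 0)); split; [left; apply exp_pos|].
assert (He := exp_pos (Rabs t / M 0)).
set (s := exp (Rabs t / M 0)) in *.
assert (H1 : M 0 <= M s) by (apply M_incr; lra).
assert (H2 : Rabs t / M 0 <= ln (1 + s)).
{ rewrite <- (ln_exp (Rabs t / M 0)); fold s; left; apply ln_increasing; lra. }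
assert (H3 : 0 < ln (1 + M s)) by (rewrite <- ln_1; apply ln_increasing; lra).
assert (H4 : 0 <= Rabs t / M 0) by (apply Rdiv_le_0_compat; [apply Rabs_pos|lra]).
apply Rle_trans with (M 0 * (Rabs t / M 0)).
- replace (M 0 * (Rabs t / M 0)) with (Rabs t) by (field; lra). apply Rle_abs.
- unfold Mlog; apply Rmult_le_compat; lra.
Qed.

Lemma Mlog_inv_spec (M : R -> R) :
  (forall s, 0 <= s -> 0 < M s) ->
  nondecreasing_on_Rplus M ->
  continuous_on Rnonneg M ->
  forall t,
  Mlog M 0 <= t -> 0 <= Mlog_inv M t /\ Mlog M (Mlog_inv M t) = t.
Proof.
intros M_pos M_incr M_cont t.
intros Ht.
apply (iota_correct (V := R_CompleteNormedModule)
         (fun s : R => 0 <= s /\ Mlog M s = t)).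
destruct (Mlog_unbounded M M_pos M_incr t) as [b [Hb Htb]].
destruct (IVT_gen (fun y => Mlog M (Rabs y)) 0 b t) as [x [_ Hx]].
- intros y; apply continuity_pt_filterlim, Mlog_Rabs_continuous; assumption.
- rewrite Rabs_R0, (Rabs_pos_eq b) by exact Hb.
  rewrite Rmin_left, Rmax_right by lra; lra.
- exists (Rabs x); split; [split; [apply Rabs_pos | exact Hx]|].
  intros y [Hy1 Hy2].
  destruct (Rtotal_order (Rabs x) y) as [H|[H|H]]; [exfalso|exact H|exfalso].
  + assert (K := Mlog_strict M M_pos M_incr _ _ (Rabs_pos x) H); lra.
  + assert (K := Mlog_strict M M_pos M_incr _ _ Hy1 H); lra.
Qed.

(* Main.v *)
Require Import Defs.
From Stdlib Require Import Reals Lra Lia List Classical IndefiniteDescription.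
From Coquelicot Require Import Coquelicot.
Open Scope R_scope.

(** Both statements say that no decay rate better than the reciprocal of the
    inverse of [Mlog M] can hold for a whole class of functions.  The proof
    tests the assumed rate on wave packets.

    Let [c = 1] for the first statement and [c = 1 + 1/beta] for the second,
    let [t] be large, and let [R] solve [c t = Mlog M R].  A packet is a
    function of height [1/R] concentrated within distance of order one from the
    time [t] and oscillating at frequency about [R], so that it is Lipschitz
    uniformly in [t].  Concretely it is a finite exponential sum, namely an
    exponential times a high power of a Dirichlet kernel ([wave_packet]).  Its
    Laplace transform is a rational function whose poles have real part below
    [-1/M(R)] and imaginary part above [R], hence lie outside [Omega M].

    The transform is estimated in two ways ([wave_packet_transform]).  For
    [|Im z| >= R] the Laplace integral converges up to the boundary of the
    region and gives the bound [e^(t/M(R))/R], up to constants.  As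
    [e^(c t/M(R)) = (1 + R)(1 + M(R))], this is [O(M(R))] when [c = 1], and for
    the larger [c] the bound remains true after multiplication by [z].  For
    [|Im z| < R] the region may extend far to the left of [-1/M(R)]; there the
    path of integration is rotated onto the positive imaginary axis, where a
    packet with frequencies above [R + 1] decays like [e^(-(R+1)s)], and the
    transform is at most [1/R].

    Finally, if [r] were not bounded by a multiple of [R], a gliding hump
    ([gliding_hump]) would superpose packets with peaks at rapidly increasing
    times into one function of the class that violates the rate.  The sum
    stays in the class because all bounds on packets are uniform and the
    transforms are uniformly Lipschitz on larger and larger horizontal strips
    ([atom_sum]). *)

(** * The complex exponential *)

Lemma Cmod_le_abs (z : C) : Cmod z <= Rabs (Re z) + Rabs (Im z).
Proof.
  destruct z as [x y]; simpl.
  replace ((x, y) : C) with (RtoC x + RtoC y * Ci)%C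
    by (unfold RtoC, Ci, Cplus, Cmult; simpl; f_equal; ring).
  eapply Rle_trans; [apply Cmod_triangle|].
  rewrite Cmod_mult, Cmod_Ci, !Cmod_R; lra.
Qed.

Lemma im_le_Cmod (z : C) : Rabs (Im z) <= Cmod z.
Proof. eapply Rle_trans; [apply Rmax_r|apply Rmax_Cmod]. Qed.

Lemma Cmod_minus_sym (a b : C) : Cmod (a - b) = Cmod (b - a).
Proof. rewrite <- Cmod_opp; f_equal; ring. Qed.

Lemma Cmod_triangle_minus (a b : C) : Cmod (a - b) <= Cmod a + Cmod b.
Proof. unfold Cminus; rewrite <- (Cmod_opp b); apply Cmod_triangle. Qed.

Lemma Cexp_plus (a b : C) : Cexp (a + b) = (Cexp a * Cexp b)%C.
Proof.
  destruct a as [x y], b as [u v]; unfold Cexp; simpl.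
  rewrite exp_plus, cos_plus, sin_plus; apply injective_projections; simpl; ring.
Qed.

Lemma Cexp_0 : Cexp 0 = 1%C.
Proof. apply injective_projections; simpl; rewrite exp_0, ?cos_0, ?sin_0; ring. Qed.

Lemma Cmod_Cexp (z : C) : Cmod (Cexp z) = exp (Re z).
Proof.
  unfold Cmod, Cexp; simpl.
  replace (_ + _) with (Rsqr (exp (Re z)) * (Rsqr (sin (Im z)) + Rsqr (cos (Im z))))
    by (unfold Rsqr; ring).
  rewrite sin2_cos2, Rmult_1_r; apply sqrt_Rsqr; left; apply exp_pos.
Qed.

Lemma one_minus_cos_le (y : R) : 1 - cos y <= y ^ 2 / 2.
Proof.
  assert (H : Rabs (sin (y / 2)) <= Rabs (y / 2)).
  { destruct (Req_dec (y/2) 0) as [->|H0]; [rewrite sin_0; lra|].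
    destruct (Rtotal_order 0 (y/2)) as [H|[H|H]].
    - rewrite (Rabs_pos_eq (y/2)) by lra.
      apply Rabs_le. split.
      + destruct (Rle_dec (y/2) PI) as [Hp|Hp].
        * assert (0 <= sin (y/2)) by (apply sin_ge_0; lra); lra.
        * assert (-1 <= sin (y/2)) by apply SIN_bound. 
          assert (2 <= PI) by (assert (P:=PI2_1); lra). lra.
      + left; apply sin_lt_x; lra.
    - lra.
    - rewrite (Rabs_left (y/2)) by lra.
      rewrite <- Rabs_Ropp, <- sin_neg.
      apply Rabs_le. split.
      + destruct (Rle_dec (-(y/2)) PI) as [Hp|Hp].
        * assert (0 <= sin (-(y/2))) by (apply sin_ge_0; lra); lra.
        * assert (-1 <= sin (-(y/2))) by apply SIN_bound. 
          assert (2 <= PI) by (assert (P:=PI2_1); lra). lra.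
      + left; apply sin_lt_x; lra. }
  replace (cos y) with (cos (2 * (y / 2))) by (f_equal; lra).
  rewrite cos_2a_sin.
  assert (Rsqr (sin (y/2)) <= Rsqr (y/2)) by (apply Rsqr_le_abs_1, H).
  unfold Rsqr in *; nra.
Qed.

(** Squaring and splitting [|e^w - 1|^2 = (e^x - 1)^2 + 2 e^x (1 - cos y)]
    reduces the estimate to one real inequality for each of [x] and [y]. *)
Lemma Cexp_sub_1 (w : C) : Cmod (Cexp w - 1) <= Cmod w * exp (Rmax (Re w) 0).
Proof.
  destruct w as [x y]; unfold Cexp; simpl Re; simpl Im.
  set (e := exp (Rmax x 0)).
  assert (He : 1 <= e) by (unfold e; eapply Rle_trans; [|apply exp_ineq1_le];
    assert (H := Rmax_r x 0); lra).
  assert (Hx : exp x <= e).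
  { unfold e; destruct (Rle_lt_or_eq_dec _ _ (Rmax_l x 0)) as [H|H];
      [left; apply exp_increasing, H|rewrite <- H; lra]. }
  assert (Hx0 := exp_pos x).
  assert (H1 : Rabs (exp x - 1) <= Rabs x * e).
  { destruct (Rle_dec 0 x) as [h|h].
    - rewrite (Rabs_pos_eq x) by lra.
      assert (G := exp_ineq1_le (-x)). rewrite exp_Ropp in G.
      assert (G' : (1 - x) * exp x <= 1).
      { apply Rmult_le_reg_r with (/ exp x); [apply Rinv_0_lt_compat; lra|].
        rewrite Rmult_assoc, Rinv_r by lra; lra. }
      assert (1 + x <= exp x) by apply exp_ineq1_le.
      rewrite Rabs_pos_eq by lra. nra.
    - rewrite (Rabs_left x) by lra.
      assert (exp x < 1) by (rewrite <- exp_0; apply exp_increasing; lra).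
      rewrite Rabs_left by lra.
      assert (1 + x <= exp x) by apply exp_ineq1_le. nra. }
  assert (H2 := one_minus_cos_le y).
  unfold Cmod; simpl.
  rewrite <- (sqrt_Rsqr e) by lra.
  rewrite <- sqrt_mult_alt by nra.
  apply sqrt_le_1_alt.
  assert (H3 : (exp x - 1) * (exp x - 1) <= x * x * (e * e)).
  { assert (Rabs (exp x - 1) <= Rabs (x * e)) by (rewrite Rabs_mult, (Rabs_pos_eq e) by lra; lra).
    apply Rsqr_le_abs_1 in H; unfold Rsqr in H; lra. }
  assert (Hsc := sin2_cos2 y); unfold Rsqr in *.
  replace ((exp x * cos y + - (1)) * ((exp x * cos y + - (1)) * 1) +
    (exp x * sin y + - 0) * ((exp x * sin y + - 0) * 1)) with
    ((exp x - 1) * (exp x - 1) + 2 * exp x * (1 - cos y) +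
     exp x * exp x * (sin y * sin y + cos y * cos y - 1)) by ring.
  rewrite Hsc.
  assert (0 <= 1 - cos y) by (assert (C := COS_bound y); lra).
  assert (2 * exp x * (1 - cos y) <= e * e * (y * y)) by (assert (Q1 : exp x * (1 - cos y) <= e * (y ^ 2 / 2)) by (apply Rmult_le_compat; lra); assert (Q2 : 0 <= (e - 1) * (e * (y * y))) by (apply Rmult_le_pos; [lra|apply Rmult_le_pos; [lra|apply Rle_0_sqr]]); lra).
  lra.
Qed.

Lemma Cexp_sub (a b : C) (m : R) : Re a <= m -> Re b <= m ->
  Cmod (Cexp a - Cexp b) <= Cmod (a - b) * exp m.
Proof.
  intros Ha Hb.
  replace (Cexp a) with (Cexp b * Cexp (a - b))%C
    by (rewrite <- Cexp_plus; f_equal; ring).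
  replace (_ - _)%C with (Cexp b * (Cexp (a - b) - 1))%C by ring.
  rewrite Cmod_mult, Cmod_Cexp.
  assert (H := Cexp_sub_1 (a - b)).
  apply Rle_trans with (exp (Re b) * (Cmod (a - b) * exp (Rmax (Re (a - b)) 0))).
  - apply Rmult_le_compat_l; [left; apply exp_pos|exact H].
  - replace (_ * _) with (Cmod (a - b) * (exp (Re b) * exp (Rmax (Re (a - b)) 0))) by ring.
    apply Rmult_le_compat_l; [apply Cmod_ge_0|].
    rewrite <- exp_plus. 
    assert (G : Re b + Rmax (Re (a - b)) 0 <= m).
    { destruct a as [a1 a2], b as [b1 b2]; simpl in *; unfold Rmax; destruct Rle_dec; simpl in *; lra. }
    destruct G as [G| ->]; [left; apply exp_increasing, G|apply Rle_refl].
Qed.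

(** * Exponential sums *)

(** A list of pairs (coefficient, frequency) encodes at the same time the sum
    of the [b e^(mu z)], its derivative and its Laplace transform, the sum of
    the [b / (z - mu)].  Identities between these three objects thereby become
    inductions on lists, and the analytic continuation of the transform is the
    rational function itself. *)
Definition expsum (l : list (C * C)) (z : C) : C :=
  fold_right (fun p acc => fst p * Cexp (snd p * z) + acc)%C 0%C l.

Definition expsum_deriv (l : list (C * C)) : list (C * C) :=
  map (fun p => (fst p * snd p, snd p)%C) l.

Definition expsum_laplace (l : list (C * C)) (z : C) : C :=
  fold_right (fun p acc => fst p / (z - snd p) + acc)%C 0%C l.

Definition freqs_in (S : C -> Prop) (l : list (C * C)) : Prop :=
  forall p, In p l -> S (snd p).

Lemma expsum_app l l' z : expsum (l ++ l') z = (expsum l z + expsum l' z)%C.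
Proof. induction l as [|p l IH]; simpl; [|rewrite IH]; ring. Qed.

Definition expsum_mul1 (p : C * C) (l : list (C * C)) : list (C * C) :=
  map (fun q => (fst p * fst q, snd p + snd q)%C) l.

Lemma expsum_mul1_eq p l z :
  expsum (expsum_mul1 p l) z = (fst p * Cexp (snd p * z) * expsum l z)%C.
Proof.
  induction l as [|q l IH]; simpl; [|rewrite IH, Cmult_plus_distr_r, Cexp_plus]; ring.
Qed.

Lemma expsum_mul1_deriv p l z :
  expsum (expsum_deriv (expsum_mul1 p l)) z =
  (fst p * snd p * Cexp (snd p * z) * expsum l z +
   fst p * Cexp (snd p * z) * expsum (expsum_deriv l) z)%C.
Proof.
  induction l as [|q l IH]; simpl; [|rewrite IH, Cmult_plus_distr_r, Cexp_plus]; ring.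
Qed.

Lemma expsum_deriv_app l l' : expsum_deriv (l ++ l') = expsum_deriv l ++ expsum_deriv l'.
Proof. apply map_app. Qed.

(** The derivative travels with the function because the frequencies of the
    test functions below are known only through products, powers and shifts;
    estimates use the factored form of [f] and [f'], transforms use the list. *)
Definition is_expsum (S : C -> Prop) (f f' : C -> C) : Prop :=
  exists l, freqs_in S l /\ (forall z, f z = expsum l z) /\
            (forall z, f' z = expsum (expsum_deriv l) z).

Lemma is_expsum_mul (S S' S'' : C -> Prop) f f' g g' :
  (forall a b, S a -> S' b -> S'' (a + b)%C) ->
  is_expsum S f f' -> is_expsum S' g g' ->
  is_expsum S'' (fun z => f z * g z)%C (fun z => f' z * g z + f z * g' z)%C.
Proof.
  intros HS (l & Hl & Hf & Hf') (l' & Hl' & Hg & Hg').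
  exists (flat_map (fun p => expsum_mul1 p l') l); repeat split.
  - intros q Hq; apply in_flat_map in Hq as (p & Hp & Hq).
    apply in_map_iff in Hq as (q' & <- & Hq'); simpl; apply HS; auto.
  - intros z; rewrite Hf, Hg; clear -l; induction l as [|p l IH]; simpl; [ring|].
    rewrite expsum_app, expsum_mul1_eq, <- IH; ring.
  - intros z; rewrite Hf, Hg, Hf', Hg'; clear -l; induction l as [|p l IH]; simpl; [ring|].
    rewrite expsum_deriv_app, expsum_app, expsum_mul1_deriv, <- IH; ring.
Qed.

Lemma is_expsum_ext (S S' : C -> Prop) f f' g g' :
  (forall a, S a -> S' a) -> (forall z, f z = g z) -> (forall z, f' z = g' z) ->
  is_expsum S f f' -> is_expsum S' g g'.
Proof.
  intros HS Hf Hf' (l & Hl & H & H'); exists l; repeat split.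
  - intros p Hp; apply HS, Hl, Hp.
  - intros z; rewrite <- Hf; apply H.
  - intros z; rewrite <- Hf'; apply H'.
Qed.

Lemma is_expsum_exp (S : C -> Prop) (b mu : C) : S mu ->
  is_expsum S (fun z => b * Cexp (mu * z))%C (fun z => b * mu * Cexp (mu * z))%C.
Proof.
  intros H; exists ((b, mu) :: nil); repeat split.
  - intros p [<- | [] ]; exact H.
  - intros z; simpl; ring.
  - intros z; simpl; ring.
Qed.

Lemma is_expsum_shift (S : C -> Prop) f f' (w : C) : is_expsum S f f' ->
  is_expsum S (fun z => f (z - w)%C) (fun z => f' (z - w)%C).
Proof.
  intros (l & Hl & Hf & Hf').
  exists (map (fun p => (fst p * Cexp (- (snd p * w)), snd p)%C) l); repeat split.
  - intros q Hq; apply in_map_iff in Hq as (p & <- & Hp); simpl; apply Hl, Hp.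
  - intros z; rewrite Hf; clear; induction l as [|p l IH]; simpl; [reflexivity|].
    rewrite <- IH. replace (snd p * (z - w))%C with (- (snd p * w) + snd p * z)%C by ring.
    rewrite Cexp_plus; ring.
  - intros z; rewrite Hf'; clear; induction l as [|p l IH]; simpl; [reflexivity|].
    rewrite <- IH. replace (snd p * (z - w))%C with (- (snd p * w) + snd p * z)%C by ring.
    rewrite Cexp_plus; ring.
Qed.

Lemma is_expsum_pow (S : C -> Prop) f f' :
  S 0%C -> (forall a b, S a -> S b -> S (a + b)%C) -> is_expsum S f f' ->
  forall n, is_expsum S (fun z => f z ^ n)%C (fun z => INR n * f z ^ pred n * f' z)%C.
Proof.
  intros S0 Sp H n; induction n as [|n IH].
  - apply (is_expsum_ext S S (fun z => 1 * Cexp (0 * z))%C (fun z => 1 * 0 * Cexp (0 * z))%C);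
      [auto| | |apply is_expsum_exp, S0]; intros z; simpl;
      [rewrite Cmult_0_l, Cexp_0|]; ring.
  - eapply is_expsum_ext; [| | |apply (is_expsum_mul S S S _ _ _ _ Sp H IH)]; [auto| |]; intros z.
    + reflexivity.
    + rewrite S_INR, RtoC_plus. destruct n as [|n]; simpl; ring.
Qed.

(** * Derivatives and improper integrals of complex-valued functions *)

(** The epsilon-delta form is the one in which a derivative can be passed
    through an infinite series. *)
Lemma is_derive_C_intro (F : C -> C) (z l : C) :
  (forall eps, 0 < eps -> exists delta, 0 < delta /\ forall h, Cmod h < delta ->
     Cmod (F (z + h) - F z - h * l)%C <= eps * Cmod h) ->
  is_derive (K := C_AbsRing) (V := C_NormedModule) F z l.
Proof.
  intros H; split; [apply (is_linear_scal_l (K := C_AbsRing) (V := C_NormedModule))|].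
  intros x Hx eps.
  assert (x = z) as ->.
  { symmetry; apply (is_filter_lim_locally_unique (K := C_AbsRing) (V := AbsRing_NormedModule C_AbsRing)), Hx. }
  apply (locally_le_locally_norm (K := C_AbsRing) (V := AbsRing_NormedModule C_AbsRing)).
  destruct (H eps (cond_pos eps)) as (d & Hd & Hh).
  exists (mkposreal d Hd); intros y Hy.
  change (Cmod (y - z) < d) in Hy.
  change (Cmod ((F y - F z) - (y - z) * l) <= eps * Cmod (y - z)).
  specialize (Hh _ Hy).
  assert (E : forall a b : C, (a + (b - a))%C = b) by (intros; ring).
  rewrite E in Hh; exact Hh.
Qed.

Lemma is_derive_C_elim (F : C -> C) (z l : C) :
  is_derive (K := C_AbsRing) (V := C_NormedModule) F z l ->
  forall eps, 0 < eps -> exists delta, 0 < delta /\ forall h, Cmod h < delta ->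
     Cmod (F (z + h) - F z - h * l)%C <= eps * Cmod h.
Proof.
  intros [_ H] eps Heps.
  specialize (H z (fun P HP => HP) (mkposreal eps Heps)).
  apply (locally_norm_le_locally (K := C_AbsRing) (V := AbsRing_NormedModule C_AbsRing)) in H.
  destruct H as [d Hd]; exists d; split; [apply cond_pos|].
  intros h Hh; specialize (Hd (z + h)%C).
  assert (E : (z + h - z)%C = h) by ring.
  change (Cmod (z + h - z) < d ->
    Cmod ((F (z + h) - F z) - (z + h - z) * l)%C <= eps * Cmod (z + h - z)) in Hd.
  rewrite E in Hd; apply Hd, Hh.
Qed.

Lemma is_derive_on_Rplus_intro (f g : R -> C) :
  (forall t, 0 <= t -> forall eps, 0 < eps -> exists delta, 0 < delta /\
     forall s, 0 <= s -> Rabs (s - t) < delta ->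
     Cmod (f s - f t - RtoC (s - t) * g t)%C <= eps * Rabs (s - t)) ->
  is_derive_on_Rplus f g.
Proof.
  intros H t Ht; split; [apply (is_linear_scal_l (K := R_AbsRing) (V := C_R_NormedModule))|].
  intros x Hx eps.
  assert (x = t) as ->.
  { symmetry; apply (is_filter_lim_locally_unique (K := R_AbsRing) (V := R_NormedModule)).
    intros P HP. 
    destruct (Req_dec t x) as [->|Hn]; [exact HP|exfalso].
    assert (Hp : 0 < Rabs (t - x) / 2) by (assert (0 < Rabs (t - x)) by (apply Rabs_pos_lt; lra); lra).
    specialize (Hx (fun y => Rabs (y - x) < Rabs (t - x) / 2)).
    destruct Hx as [d Hd]; [exists (mkposreal _ Hp); intros y Hy; exact Hy|].
    specialize (Hd t (ball_center t d) Ht); lra. }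
  destruct (H t Ht eps (cond_pos eps)) as (d & Hd & Hh).
  exists (mkposreal d Hd); intros y Hy Hy0.
  specialize (Hh y Hy0 Hy).
  rewrite Cmod_norm in Hh.
  replace (RtoC (y - t) * g t)%C with (scal (V := C_R_NormedModule) (y - t) (g t)) in Hh.
  - exact Hh.
  - apply injective_projections; simpl; unfold scal; simpl; unfold mult; simpl; ring.
Qed.

Definition is_derive_RC (f : R -> C) (t : R) (l : C) : Prop :=
  is_derive (fun s => Re (f s)) t (Re l) /\ is_derive (fun s => Im (f s)) t (Im l).

Lemma is_derive_R_elim (f : R -> R) (t l : R) : is_derive f t l ->
  forall eps, 0 < eps -> exists delta, 0 < delta /\ forall s, Rabs (s - t) < delta ->
     Rabs (f s - f t - (s - t) * l) <= eps * Rabs (s - t).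
Proof.
  intros [_ H] eps Heps.
  destruct (H t (fun P HP => HP) (mkposreal eps Heps)) as [d Hd].
  exists d; split; [apply cond_pos|]; intros s Hs; exact (Hd s Hs).
Qed.

Lemma is_derive_RC_elim (f : R -> C) (t : R) (l : C) : is_derive_RC f t l ->
  forall eps, 0 < eps -> exists delta, 0 < delta /\ forall s, Rabs (s - t) < delta ->
     Cmod (f s - f t - RtoC (s - t) * l)%C <= eps * Rabs (s - t).
Proof.
  intros [H1 H2] eps Heps.
  destruct (is_derive_R_elim _ _ _ H1 (eps / 2)) as (d1 & Hd1 & G1); [lra|].
  destruct (is_derive_R_elim _ _ _ H2 (eps / 2)) as (d2 & Hd2 & G2); [lra|].
  exists (Rmin d1 d2); split; [apply Rmin_pos; assumption|]; intros s Hs.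
  specialize (G1 s (Rlt_le_trans _ _ _ Hs (Rmin_l _ _))).
  specialize (G2 s (Rlt_le_trans _ _ _ Hs (Rmin_r _ _))).
  eapply Rle_trans; [apply Cmod_le_abs|].
  replace (Re (f s - f t - RtoC (s - t) * l)%C) with (Re (f s) - Re (f t) - (s - t) * Re l)
    by (unfold Re; simpl; ring).
  replace (Im (f s - f t - RtoC (s - t) * l)%C) with (Im (f s) - Im (f t) - (s - t) * Im l)
    by (unfold Im; simpl; ring).
  lra.
Qed.

Lemma is_RInt_RC (f g : R -> C) (a b : R) :
  (forall t, is_derive_RC f t (g t)) -> (forall t, exists l, is_derive_RC g t l) ->
  is_RInt (V := C_R_NormedModule) g a b (f b - f a)%C.
Proof.
  intros Hf Hg.
  replace (f b - f a)%C with ((Re (f b) - Re (f a), Im (f b) - Im (f a)) : C)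
    by (apply injective_projections; unfold Re, Im; simpl; ring).
  apply (is_RInt_fct_extend_pair (U := R_NormedModule) (V := R_NormedModule)).
  - apply (is_RInt_derive (V := R_CompleteNormedModule) (fun s => Re (f s)) (fun s => fst (g s)));
      intros x _; [apply Hf|].
    destruct (Hg x) as [l [H _]].
    apply (ex_derive_continuous (K := R_AbsRing) (V := R_NormedModule)); eexists; exact H.
  - apply (is_RInt_derive (V := R_CompleteNormedModule) (fun s => Im (f s)) (fun s => snd (g s)));
      intros x _; [apply Hf|].
    destruct (Hg x) as [l [_ H]].
    apply (ex_derive_continuous (K := R_AbsRing) (V := R_NormedModule)); eexists; exact H.
Qed.

Lemma Cmod_RInt_le (g : R -> C) (phi : R -> R) (a b : R) (I : C) (J : R) : a <= b ->
  (forall t, a <= t <= b -> Cmod (g t) <= phi t) ->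
  is_RInt (V := C_R_NormedModule) g a b I -> is_RInt phi a b J -> Cmod I <= J.
Proof.
  intros Hab H HI HJ; rewrite Cmod_norm.
  apply (norm_RInt_le (V := C_R_NormedModule) g phi a b I J Hab); try assumption.
  intros x Hx; specialize (H x Hx); rewrite Cmod_norm in H; exact H.
Qed.

Lemma is_RInt_gen_0_infty_intro (f I : R -> C) (l : C) :
  (forall T, 0 <= T -> is_RInt (V := C_R_NormedModule) f 0 T (I T)) ->
  (forall eps, 0 < eps -> exists T0, forall T, T0 <= T -> Cmod (I T - l) <= eps) ->
  is_RInt_gen (V := C_R_NormedModule) f (at_point 0) (Rbar_locally p_infty) l.
Proof.
  intros HI Hl P HP.
  apply (locally_norm_le_locally (K := R_AbsRing) (V := C_R_NormedModule)) in HP.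
  destruct HP as [d Hd].
  destruct (Hl (d / 2)) as [T0 HT]; [destruct d; simpl; lra|].
  exists (fun x => x = 0) (fun y => Rmax 0 T0 < y); [reflexivity|exists (Rmax 0 T0); auto|].
  intros x y -> Hy; simpl.
  assert (A := Rmax_l 0 T0); assert (B := Rmax_r 0 T0).
  exists (I y); split; [apply HI; lra|].
  apply Hd.
  assert (E := HT y ltac:(lra)). rewrite Cmod_norm in E.
  unfold ball_norm. eapply Rle_lt_trans; [exact E|]. destruct d; simpl; lra.
Qed.

Lemma is_RInt_gen_0_infty_elim (f : R -> C) (l : C) :
  is_RInt_gen (V := C_R_NormedModule) f (at_point 0) (Rbar_locally p_infty) l ->
  forall eps, 0 < eps -> exists T0, forall T, T0 <= T ->
    exists I, is_RInt (V := C_R_NormedModule) f 0 T I /\ Cmod (I - l) <= eps.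
Proof.
  intros H eps Heps.
  destruct (H (fun y => Cmod (y - l) <= eps)) as [Q S HQ [T0 HS] HP].
  - apply (locally_le_locally_norm (K := R_AbsRing) (V := C_R_NormedModule)).
    exists (mkposreal eps Heps); intros y Hy; left; rewrite Cmod_norm; exact Hy.
  - exists (T0 + 1); intros T HT; exact (HP 0 T HQ (HS T ltac:(lra))).
Qed.

Lemma is_derive_RC_expsum (l : list (C * C)) (t : R) :
  is_derive_RC (fun s => expsum l (RtoC s)) t (expsum (expsum_deriv l) (RtoC t)).
Proof.
  induction l as [|[[b1 b2] [m1 m2]] l [IH1 IH2]].
  - split; exact (is_derive_const (K := R_AbsRing) (V := R_NormedModule) 0 t).
  - split.
    + apply (is_derive_ext (fun s => (b1 * (exp (m1 * s) * cos (m2 * s)) -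
        b2 * (exp (m1 * s) * sin (m2 * s))) + Re (expsum l (RtoC s)))).
      { intros s; simpl. unfold Re at 1; simpl. replace (m1 * s - m2 * 0) with (m1 * s) by ring.
        replace (m1 * 0 + m2 * s) with (m2 * s) by ring. unfold Re; ring. }
      simpl. unfold Re at 1; simpl.
      replace (m1 * t - m2 * 0) with (m1 * t) by ring.
      replace (m1 * 0 + m2 * t) with (m2 * t) by ring.
      apply (is_derive_plus (K := R_AbsRing) (V := R_NormedModule)); [|exact IH1].
      auto_derive; [exact I|ring].
    + apply (is_derive_ext (fun s => (b1 * (exp (m1 * s) * sin (m2 * s)) +
        b2 * (exp (m1 * s) * cos (m2 * s))) + Im (expsum l (RtoC s)))).
      { intros s; simpl. unfold Im at 1; simpl. replace (m1 * s - m2 * 0) with (m1 * s) by ring.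
        replace (m1 * 0 + m2 * s) with (m2 * s) by ring. unfold Im; ring. }
      simpl. unfold Im at 1; simpl.
      replace (m1 * t - m2 * 0) with (m1 * t) by ring.
      replace (m1 * 0 + m2 * t) with (m2 * t) by ring.
      apply (is_derive_plus (K := R_AbsRing) (V := R_NormedModule)); [|exact IH2].
      auto_derive; [exact I|ring].
Qed.

(** * Laplace transforms of exponential sums *)

Definition expsum_prim (l : list (C * C)) : list (C * C) :=
  map (fun p => (fst p / snd p, snd p)%C) l.

Lemma expsum_deriv_prim (l : list (C * C)) :
  freqs_in (fun mu => Re mu < 0) l -> expsum_deriv (expsum_prim l) = l.
Proof.
  intros H; unfold expsum_deriv, expsum_prim; rewrite map_map.
  rewrite <- map_id; apply map_ext_in; intros [b mu] Hp; simpl.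
  f_equal; field; intros E.
  specialize (H _ Hp); simpl in H; rewrite E in H; simpl in H; lra.
Qed.

Lemma expsum_prim_0 (l : list (C * C)) :
  freqs_in (fun mu => Re mu < 0) l -> expsum (expsum_prim l) 0 = (- expsum_laplace l 0)%C.
Proof.
  induction l as [|[b mu] l IH]; intros H; simpl; [ring|].
  rewrite IH by (intros p Hp; apply H; right; exact Hp).
  assert (mu <> 0)%C.
  { intros E. specialize (H _ (or_introl eq_refl)); simpl in H; rewrite E in H; simpl in H; lra. }
  rewrite Cmult_0_r, Cexp_0; field; exact H0.
Qed.

Lemma expsum_vanishes (l : list (C * C)) : freqs_in (fun mu => Re mu < 0) l ->
  forall eps, 0 < eps -> exists T0, forall T, T0 <= T -> Cmod (expsum l (RtoC T)) <= eps.
Proof.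
  induction l as [|[b mu] l IH]; intros H eps Heps; simpl.
  - exists 0; intros T _; rewrite Cmod_0; lra.
  - destruct (IH (fun p Hp => H p (or_intror Hp)) (eps / 2)) as [T1 HT1]; [lra|].
    assert (Hm := H _ (or_introl eq_refl)); simpl in Hm.
    set (c := Cmod b); assert (Hc : 0 <= c) by apply Cmod_ge_0.
    exists (Rmax T1 (2 * c / eps / - Re mu)); intros T HT.
    assert (HTa := Rle_trans _ _ _ (Rmax_l _ _) HT).
    assert (HTb := Rle_trans _ _ _ (Rmax_r _ _) HT).
    eapply Rle_trans; [apply Cmod_triangle|].
    rewrite Cmod_mult, Cmod_Cexp; fold c.
    replace (Re (mu * T)) with (- (- Re mu * T)) by (unfold Re; simpl; ring).
    specialize (HT1 T HTa).
    assert (2 * c / eps <= - Re mu * T).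
    { apply Rmult_le_compat_l with (r := - Re mu) in HTb; [|lra].
      replace (- Re mu * (2 * c / eps / - Re mu)) with (2 * c / eps) in HTb by (field; lra). lra. }
    rewrite exp_Ropp.
    assert (G := exp_ineq1_le (- Re mu * T)).
    assert (0 <= 2 * c / eps) by (apply Rdiv_le_0_compat; lra).
    assert (c * / exp (- Re mu * T) <= eps / 2); [|lra].
    apply Rmult_le_reg_r with (exp (- Re mu * T)); [lra|].
    rewrite Rmult_assoc, Rinv_l by lra.
    apply Rle_trans with (eps / 2 * (2 * c / eps)); [right; field; lra|].
    apply Rmult_le_compat_l; lra.
Qed.

Lemma expsum_prim_freqs (S : C -> Prop) l : freqs_in S l -> freqs_in S (expsum_prim l).
Proof. intros H p Hp; apply in_map_iff in Hp as (q & <- & Hq); exact (H q Hq). Qed.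

Lemma is_RInt_expsum (l : list (C * C)) (T : R) : freqs_in (fun mu => Re mu < 0) l ->
  is_RInt (V := C_R_NormedModule) (fun s => expsum l (RtoC s)) 0 T
    (expsum (expsum_prim l) (RtoC T) + expsum_laplace l 0)%C.
Proof.
  intros H.
  replace (_ + _)%C with (expsum (expsum_prim l) (RtoC T) - expsum (expsum_prim l) (RtoC 0))%C
    by (rewrite expsum_prim_0 by exact H; ring).
  apply (is_RInt_RC (fun s => expsum (expsum_prim l) (RtoC s))).
  - intros t; assert (D := is_derive_RC_expsum (expsum_prim l) t).
    rewrite expsum_deriv_prim in D by exact H; exact D.
  - intros t; eexists; apply is_derive_RC_expsum.
Qed.

Lemma is_RInt_gen_expsum (l : list (C * C)) : freqs_in (fun mu => Re mu < 0) l ->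
  is_RInt_gen (V := C_R_NormedModule) (fun s => expsum l (RtoC s))
    (at_point 0) (Rbar_locally p_infty) (expsum_laplace l 0).
Proof.
  intros H; eapply is_RInt_gen_0_infty_intro; [intros T _; apply is_RInt_expsum, H|].
  intros eps Heps.
  destruct (expsum_vanishes _ (expsum_prim_freqs _ _ H) eps Heps) as [T0 HT].
  exists T0; intros T HTT; replace (_ - _)%C with (expsum (expsum_prim l) (RtoC T)) by ring; auto.
Qed.

(** The majorant [phi] comes with a primitive [Phi], so that no improper integral
    of [phi] has to be constructed: the bound on each finite interval passes to
    the limit. *)
Lemma expsum_laplace_0_bound (l : list (C * C)) (phi Phi : R -> R) (B : R) :
  freqs_in (fun mu => Re mu < 0) l ->
  (forall s, 0 <= s -> Cmod (expsum l (RtoC s)) <= phi s) ->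
  (forall s, is_derive Phi s (phi s)) -> (forall s, continuous phi s) ->
  (forall T, 0 <= T -> Phi T - Phi 0 <= B) ->
  Cmod (expsum_laplace l 0) <= B.
Proof.
  intros H Hphi HPhi Hc HB.
  apply Rnot_lt_le; intros Hlt.
  set (eps := (Cmod (expsum_laplace l 0) - B) / 2).
  destruct (expsum_vanishes _ (expsum_prim_freqs _ _ H) eps) as [T0 HT]; [unfold eps; lra|].
  set (T := Rmax 0 T0); assert (A1 := Rmax_l 0 T0); assert (A2 := Rmax_r 0 T0); fold T in A1, A2.
  specialize (HT T A2).
  assert (E : Cmod (expsum (expsum_prim l) (RtoC T) + expsum_laplace l 0)%C <= Phi T - Phi 0).
  { apply (Cmod_RInt_le (fun s => expsum l (RtoC s)) phi 0 T); [exact A1|intros; apply Hphi; lra| |].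
    - apply is_RInt_expsum, H.
    - apply (is_RInt_derive (V := R_CompleteNormedModule)); intros; auto. }
  assert (E2 : Cmod (expsum_laplace l 0) <=
    Cmod (expsum (expsum_prim l) (RtoC T) + expsum_laplace l 0)%C + Cmod (expsum (expsum_prim l) (RtoC T))).
  { replace (expsum_laplace l 0) with ((expsum (expsum_prim l) (RtoC T) + expsum_laplace l 0)
      - expsum (expsum_prim l) (RtoC T))%C at 1 by ring. apply Cmod_triangle_minus. }
  specialize (HB T A1); unfold eps in HT; lra.
Qed.

(** Multiplying by [e^(-wz)] shifts all frequencies by [-w]; this reduces the
    transform at [w] to the integral of an exponential sum with decaying terms. *)
Definition expsum_translate (w : C) (l : list (C * C)) : list (C * C) :=
  map (fun p => (fst p, snd p - w)%C) l.

Lemma expsum_translate_eq (w : C) l z :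
  expsum (expsum_translate w l) z = (Cexp (- (w * z)) * expsum l z)%C.
Proof.
  induction l as [|p l IH]; simpl; [ring|]. rewrite IH.
  replace ((snd p - w) * z)%C with (- (w * z) + snd p * z)%C by ring.
  rewrite Cexp_plus; ring.
Qed.

Lemma expsum_laplace_translate (w : C) l :
  expsum_laplace (expsum_translate w l) 0 = expsum_laplace l w.
Proof.
  induction l as [|p l IH]; simpl; [reflexivity|]. rewrite IH. replace (0 - (snd p - w))%C with (w - snd p)%C by ring; reflexivity.
Qed.

Lemma expsum_translate_freqs (w : C) l : freqs_in (fun mu => Re mu < Re w) l ->
  freqs_in (fun mu => Re mu < 0) (expsum_translate w l).
Proof.
  intros H p Hp; apply in_map_iff in Hp as (q & <- & Hq); specialize (H q Hq).
  destruct q as [b [m1 m2]], w as [w1 w2]; simpl in *; lra.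
Qed.

Lemma laplace_expsum (l : list (C * C)) (z : C) : freqs_in (fun mu => Re mu < Re z) l ->
  is_RInt_gen (V := C_R_NormedModule)
    (fun s : R => (Cexp (- (z * RtoC s)) * expsum l (RtoC s))%C)
    (at_point 0) (Rbar_locally p_infty) (expsum_laplace l z).
Proof.
  intros H; rewrite <- expsum_laplace_translate.
  eapply is_RInt_gen_ext; [|apply is_RInt_gen_expsum, expsum_translate_freqs, H].
  exists (fun _ => True) (fun _ => True); [exact I|exists 0; auto|].
  intros x y _ _ s _; apply expsum_translate_eq.
Qed.

Lemma expsum_laplace_bound (l : list (C * C)) (z : C) (phi Phi : R -> R) (B : R) :
  freqs_in (fun mu => Re mu < Re z) l ->
  (forall s, 0 <= s -> exp (- (Re z * s)) * Cmod (expsum l (RtoC s)) <= phi s) ->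
  (forall s, is_derive Phi s (phi s)) -> (forall s, continuous phi s) ->
  (forall T, 0 <= T -> Phi T - Phi 0 <= B) ->
  Cmod (expsum_laplace l z) <= B.
Proof.
  intros H Hphi HPhi Hc HB; rewrite <- expsum_laplace_translate.
  apply (expsum_laplace_0_bound _ phi Phi); auto using expsum_translate_freqs.
  intros s Hs; rewrite expsum_translate_eq, Cmod_mult, Cmod_Cexp.
  replace (Re (- (z * s))) with (- (Re z * s)) by (destruct z; simpl; ring). auto.
Qed.

(** Turning the path of integration from the positive real to the positive
    imaginary half-axis.  For a rational transform this contour change is the
    identity [b / (z - mu) = i b / (i z - i mu)], and the rotated integral
    converges as soon as all frequencies lie above [z], wherever [Re z] is. *)
Definition expsum_rotate (l : list (C * C)) : list (C * C) :=
  map (fun p => (Ci * fst p, Ci * snd p)%C) l.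

Lemma expsum_rotate_eq l z : expsum (expsum_rotate l) z = (Ci * expsum l (Ci * z))%C.
Proof.
  induction l as [|p l IH]; simpl; [ring|]. rewrite IH.
  replace (Ci * snd p * z)%C with (snd p * (Ci * z))%C by ring. ring.
Qed.

Lemma Ci_neq_0 : Ci <> 0%C.
Proof. intros H; injection H; lra. Qed.

Lemma expsum_laplace_rotate l z : freqs_in (fun mu => mu <> z) l ->
  expsum_laplace (expsum_rotate l) (Ci * z) = expsum_laplace l z.
Proof.
  induction l as [|p l IH]; intros H; simpl; [reflexivity|].
  rewrite IH by (intros q Hq; apply H; right; exact Hq).
  f_equal. assert (snd p <> z) by (apply H; left; reflexivity).
  assert (z - snd p <> 0)%C.
  { intros E; apply H0. replace z with ((z - snd p) + snd p)%C by ring. rewrite E; ring. }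
  assert (HC := Ci_neq_0).
  field; split; [assumption|].
  replace (Ci * z - Ci * snd p)%C with (Ci * (z - snd p))%C by ring.
  apply Cmult_neq_0; assumption.
Qed.

Lemma expsum_laplace_sub_bound (l : list (C * C)) (z z' : C) (phi Phi : R -> R) (B : R) :
  freqs_in (fun mu => Re mu < Re z) l -> freqs_in (fun mu => Re mu < Re z') l ->
  (forall s, 0 <= s -> Cmod (Cexp (- (z * RtoC s)) - Cexp (- (z' * RtoC s)))%C
      * Cmod (expsum l (RtoC s)) <= phi s) ->
  (forall s, is_derive Phi s (phi s)) -> (forall s, continuous phi s) ->
  (forall T, 0 <= T -> Phi T - Phi 0 <= B) ->
  Cmod (expsum_laplace l z - expsum_laplace l z')%C <= B.
Proof.
  intros H H' Hphi HPhi Hc HB.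
  set (neg := map (fun p : C * C => (- fst p, snd p)%C)).
  assert (N1 : forall l z, expsum (neg l) z = (- expsum l z)%C).
  { intros k w; induction k as [|p k IH]; simpl; [ring|rewrite IH; ring]. }
  assert (N2 : forall l z, expsum_laplace (neg l) z = (- expsum_laplace l z)%C).
  { intros k w; induction k as [|p k IH]; simpl; [ring|rewrite IH; unfold Cdiv; ring]. }
  assert (N3 : forall l l' z, expsum_laplace (l ++ l') z = (expsum_laplace l z + expsum_laplace l' z)%C).
  { intros k k' w; induction k as [|p k IH]; simpl; [ring|rewrite IH; ring]. }
  replace (_ - _)%C with
    (expsum_laplace (expsum_translate z l ++ neg (expsum_translate z' l)) 0).
  2:{ rewrite N3, N2, !expsum_laplace_translate; ring. }
  apply (expsum_laplace_0_bound _ phi Phi); auto.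
  - intros p Hp; apply in_app_or in Hp as [Hp|Hp].
    + exact (expsum_translate_freqs _ _ H p Hp).
    + apply in_map_iff in Hp as (q & <- & Hq). exact (expsum_translate_freqs _ _ H' q Hq).
  - intros s Hs; rewrite expsum_app, N1, !expsum_translate_eq.
    replace (_ + _)%C with ((Cexp (- (z * s)) - Cexp (- (z' * s))) * expsum l s)%C by ring.
    rewrite Cmod_mult; auto.
Qed.

Lemma expsum_laplace_analytic (l : list (C * C)) (z : C) : freqs_in (fun mu => mu <> z) l ->
  ex_derive (K := C_AbsRing) (V := C_NormedModule) (expsum_laplace l) z.
Proof.
  induction l as [|[b mu] l IH]; intros H.
  - exists zero. apply (is_derive_const (K := C_AbsRing) (V := C_NormedModule)).
  - apply (ex_derive_plus (K := C_AbsRing) (V := C_NormedModule)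
      (fun z => b / (z - mu))%C (expsum_laplace l));
      [|apply IH; intros q Hq; apply H; right; exact Hq].
    assert (Hn : (z - mu)%C <> 0%C).
    { intros E; apply (H _ (or_introl eq_refl)); simpl.
      replace z with ((z - mu) + mu)%C by ring. rewrite E; ring. }
    set (w := (z - mu)%C) in *.
    assert (Hw : 0 < Cmod w) by (apply Cmod_gt_0, Hn).
    exists (- (b / (w * w)))%C; apply is_derive_C_intro; intros eps Heps.
    set (K := 2 * Cmod b / (Cmod w * Cmod w * Cmod w)).
    assert (HK : 0 <= K).
    { assert (B := Cmod_ge_0 b). unfold K; apply Rdiv_le_0_compat; [lra|].
      repeat apply Rmult_lt_0_compat; lra. }
    exists (Rmin (Cmod w / 2) (eps / (K + 1))); split.
    { apply Rmin_pos; [lra|apply Rdiv_lt_0_compat; lra]. }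
    intros h Hh.
    assert (Ha := Rlt_le_trans _ _ _ Hh (Rmin_l _ _)).
    assert (Hb := Rlt_le_trans _ _ _ Hh (Rmin_r _ _)).
    assert (Hwh : Cmod w / 2 <= Cmod (w + h)%C).
    { assert (Cmod w <= Cmod (w + h)%C + Cmod h); [|lra].
      replace w with ((w + h) - h)%C at 1 by ring. apply Cmod_triangle_minus. }
    assert (Hn2 : (w + h <> 0)%C) by (apply Cmod_gt_0; lra).
    replace (z + h - mu)%C with (w + h)%C by (unfold w; ring).
    fold w.
    replace (b / (w + h) - b / w - h * - (b / (w * w)))%C with
      (b * (h * h) / (w * w * (w + h)))%C by (field; split; assumption).
    rewrite Cmod_div by (repeat apply Cmult_neq_0; assumption).
    rewrite !Cmod_mult.
    assert (Hh0 := Cmod_ge_0 h). assert (Hb0 := Cmod_ge_0 b).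
    apply Rle_trans with (K * Cmod h * Cmod h).
    + unfold K, Rdiv.
      replace (2 * Cmod b * / (Cmod w * Cmod w * Cmod w) * Cmod h * Cmod h) with
        (Cmod b * (Cmod h * Cmod h) * / (Cmod w * Cmod w * (Cmod w / 2))) by (field; lra).
      apply Rmult_le_compat_l; [apply Rmult_le_pos; [lra|apply Rmult_le_pos; lra]|].
      apply Rinv_le_contravar; [repeat apply Rmult_lt_0_compat; lra|].
      apply Rmult_le_compat_l; [apply Rmult_le_pos; lra|exact Hwh].
    + apply Rmult_le_compat_r; [lra|].
      apply Rle_trans with (K * (eps / (K + 1))); [apply Rmult_le_compat_l; lra|].
      apply Rmult_le_reg_r with (K + 1); [lra|].
      replace (K * (eps / (K + 1)) * (K + 1)) with (K * eps) by (field; lra). nra.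
Qed.

(** Integration by parts on the transform side. *)
Lemma expsum_laplace_deriv l z : freqs_in (fun mu => mu <> z) l ->
  expsum_laplace (expsum_deriv l) z = (z * expsum_laplace l z - expsum l 0)%C.
Proof.
  induction l as [|[b mu] l IH]; intros H; simpl; [ring|].
  rewrite IH by (intros q Hq; apply H; right; exact Hq).
  assert (Hn : (z - mu)%C <> 0%C).
  { intros E; apply (H _ (or_introl eq_refl)); simpl.
    replace z with ((z - mu) + mu)%C by ring. rewrite E; ring. }
  rewrite Cmult_0_r, Cexp_0; field; exact Hn.
Qed.

Lemma expsum_lipschitz l : freqs_in (fun mu => Re mu <= 0) l ->
  exists K, 0 <= K /\ forall s t, 0 <= s -> 0 <= t ->
    Cmod (expsum l (RtoC s) - expsum l (RtoC t))%C <= K * Rabs (s - t).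
Proof.
  induction l as [|[b mu] l IH]; intros H.
  - exists 0; split; [lra|]; intros s t _ _; simpl.
    replace (0 - 0)%C with (RtoC 0) by ring; rewrite Cmod_0; lra.
  - destruct (IH (fun p Hp => H p (or_intror Hp))) as [K [HK0 HK]].
    assert (Hm := H _ (or_introl eq_refl)); simpl in Hm.
    assert (B0 := Cmod_ge_0 b). assert (B1 := Cmod_ge_0 mu).
    exists (K + Cmod b * Cmod mu); split; [nra|]; intros s t Hs Ht; simpl.
    replace (_ - _)%C with (b * (Cexp (mu * s) - Cexp (mu * t)) + (expsum l s - expsum l t))%C by ring.
    eapply Rle_trans; [apply Cmod_triangle|]. specialize (HK s t Hs Ht).
    assert (E : Cmod (Cexp (mu * s) - Cexp (mu * t)) <= Cmod mu * Rabs (s - t)).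
    { eapply Rle_trans; [apply (Cexp_sub _ _ 0)|].
      - destruct mu; simpl in *; nra.
      - destruct mu; simpl in *; nra.
      - rewrite exp_0, Rmult_1_r. replace (mu * s - mu * t)%C with (mu * RtoC (s - t))%C
          by (rewrite RtoC_minus; ring).
        rewrite Cmod_mult, Cmod_R; lra. }
    rewrite Cmod_mult.
    apply Rmult_le_compat_l with (r := Cmod b) in E; lra.
Qed.

(** * Absolutely convergent series and dominated convergence *)

Fixpoint psum (u : nat -> C) (n : nat) : C :=
  match n with O => 0%C | S k => (psum u k + u k)%C end.

Definition is_csum (u : nat -> C) (l : C) : Prop :=
  forall eps, 0 < eps -> exists N0, forall N, (N0 <= N)%nat -> Cmod (l - psum u N) <= eps.

(** Coefficients that at least halve at each step have tails dominated by twice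
    their first term, which is the only summability used below. *)
Definition halving (c : nat -> R) : Prop := forall n, 0 < c n /\ c (S n) <= c n / 2.

Lemma halving_small c : halving c -> forall eps, 0 < eps ->
  exists N0, forall n, (N0 <= n)%nat -> c n <= eps.
Proof.
  intros Hc eps Heps.
  assert (B : forall n, c n <= c O * (/ 2) ^ n).
  { induction n as [|n IH]; simpl; [lra|]. destruct (Hc n); lra. }
  assert (H0 := proj1 (Hc O)).
  destruct (pow_lt_1_zero (/ 2)) with (y := eps / c O) as [N HN];
    [rewrite Rabs_pos_eq; lra|apply Rdiv_lt_0_compat; lra|].
  exists N; intros n Hn; specialize (HN n Hn).
  rewrite Rabs_pos_eq in HN by (apply pow_le; lra).
  eapply Rle_trans; [apply B|].
  apply Rmult_lt_compat_l with (r := c O) in HN; [|lra].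
  replace (c O * (eps / c O)) with eps in HN by (field; lra); lra.
Qed.

Lemma halving_decr c : halving c -> forall m n, (m <= n)%nat -> c n <= c m.
Proof.
  intros Hc m n H; induction H as [|n _ IH]; [lra|]. destruct (Hc n); lra.
Qed.

Lemma psum_sub_bound (c : nat -> R) (K : R) (u : nat -> C) (N : nat) : halving c ->
  (forall n, (N <= n)%nat -> Cmod (u n) <= c n * K) ->
  forall n, (N <= n)%nat -> Cmod (psum u n - psum u N) <= 2 * c N * K - 2 * c n * K.
Proof.
  intros Hc Hu.
  assert (HK : 0 <= K).
  { apply Rmult_le_reg_l with (c N); [apply Hc|]. rewrite Rmult_0_r.
    eapply Rle_trans; [apply Cmod_ge_0|apply Hu; lia]. }
  intros n H; induction H as [|n H IH].
  - replace (_ - _)%C with (RtoC 0) by ring; rewrite Cmod_0; lra.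
  - simpl; replace (_ - _)%C with (psum u n - psum u N + u n)%C by ring.
    eapply Rle_trans; [apply Cmod_triangle|].
    specialize (Hu n H); destruct (Hc n); nra.
Qed.

Lemma is_csum_bound (c : nat -> R) (K : R) (u : nat -> C) (l : C) (N : nat) : halving c ->
  (forall n, (N <= n)%nat -> Cmod (u n) <= c n * K) -> is_csum u l ->
  Cmod (l - psum u N) <= 2 * c N * K.
Proof.
  intros Hc Hu Hl.
  assert (HK : 0 <= K).
  { apply Rmult_le_reg_l with (c N); [apply Hc|]. rewrite Rmult_0_r.
    eapply Rle_trans; [apply Cmod_ge_0|apply Hu; lia]. }
  apply le_epsilon; intros eps Heps.
  destruct (Hl eps Heps) as [N0 HN].
  specialize (HN (N0 + N)%nat ltac:(lia)).
  assert (H := psum_sub_bound c K u N Hc Hu (N0 + N)%nat ltac:(lia)).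
  replace (l - psum u N)%C with (l - psum u (N0 + N) + (psum u (N0 + N) - psum u N))%C by ring.
  eapply Rle_trans; [apply Cmod_triangle|].
  assert (0 <= 2 * c (N0 + N)%nat * K); [|lra].
  apply Rmult_le_pos; [|exact HK]. assert (G := proj1 (Hc (N0 + N)%nat)); lra.
Qed.

Lemma is_csum_ex (c : nat -> R) (K : R) (u : nat -> C) (N : nat) : halving c ->
  (forall n, (N <= n)%nat -> Cmod (u n) <= c n * K) -> exists l, is_csum u l.
Proof.
  intros Hc Hu.
  assert (HK : 0 <= K).
  { apply Rmult_le_reg_l with (c N); [apply Hc|]. rewrite Rmult_0_r.
    eapply Rle_trans; [apply Cmod_ge_0|apply Hu; lia]. }
  assert (Cau : forall eps, 0 < eps -> exists N0, forall m n, (N0 <= m)%nat -> (N0 <= n)%nat ->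
    Cmod (psum u m - psum u n) < eps).
  { intros eps Heps.
    destruct (halving_small c Hc (eps / (8 * (K + 1)))) as [N1 HN1]; [apply Rdiv_lt_0_compat; lra|].
    exists (N1 + N)%nat; intros m n Hm Hn.
    set (p := (N1 + N)%nat) in *.
    assert (Hp : forall q, (p <= q)%nat -> Cmod (psum u q - psum u p) <= eps / 4).
    { intros q Hq.
      eapply Rle_trans; [apply (psum_sub_bound c K u p Hc); [intros; apply Hu; lia|exact Hq]|].
      assert (A := HN1 p ltac:(lia)). assert (B := proj1 (Hc q)).
      assert (0 <= c q * K) by (apply Rmult_le_pos; lra).
      assert (c p * K <= eps / (8 * (K + 1)) * (K + 1)).
      { apply Rmult_le_compat; try lra. left; apply Hc. }
      replace (eps / (8 * (K + 1)) * (K + 1)) with (eps / 8) in H0 by (field; lra). lra. }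
    replace (psum u m - psum u n)%C with
      ((psum u m - psum u p) - (psum u n - psum u p))%C by ring.
    eapply Rle_lt_trans; [apply Cmod_triangle_minus|].
    assert (A := Hp m Hm); assert (B := Hp n Hn); lra. }
  destruct (Rcomplete.R_complete (fun n => Re (psum u n))) as [x Hx].
  { intros eps Heps; destruct (Cau eps Heps) as [N0 HN]; exists N0; intros m n Hm Hn.
    eapply Rle_lt_trans; [|apply (HN m n Hm Hn)].
    unfold Rdist. replace (Re (psum u m) - Re (psum u n)) with (Re (psum u m - psum u n)) by reflexivity.
    apply re_le_Cmod. }
  destruct (Rcomplete.R_complete (fun n => Im (psum u n))) as [y Hy].
  { intros eps Heps; destruct (Cau eps Heps) as [N0 HN]; exists N0; intros m n Hm Hn.
    eapply Rle_lt_trans; [|apply (HN m n Hm Hn)].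
    unfold Rdist. replace (Im (psum u m) - Im (psum u n)) with (Im (psum u m - psum u n)) by reflexivity.
    apply im_le_Cmod. }
  exists (x, y); intros eps Heps.
  destruct (Hx (eps / 2)) as [N1 H1]; [lra|].
  destruct (Hy (eps / 2)) as [N2 H2]; [lra|].
  exists (N1 + N2)%nat; intros n Hn.
  specialize (H1 n ltac:(lia)); specialize (H2 n ltac:(lia)); unfold Rdist in *.
  rewrite Cmod_minus_sym.
  eapply Rle_trans; [apply Cmod_le_abs|].
  change (Rabs (Re (psum u n) - x) + Rabs (Im (psum u n) - y) <= eps); lra.
Qed.

Lemma is_csum_lin (u v : nat -> C) (l l' k : C) : is_csum u l -> is_csum v l' ->
  is_csum (fun n => u n - k * v n)%C (l - k * l')%C.
Proof.
  intros Hu Hv eps Heps.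
  assert (K0 := Cmod_ge_0 k).
  destruct (Hu (eps / 2)) as [N1 H1]; [lra|].
  destruct (Hv (eps / (2 * (Cmod k + 1)))) as [N2 H2]; [apply Rdiv_lt_0_compat; lra|].
  exists (N1 + N2)%nat; intros n Hn.
  specialize (H1 n ltac:(lia)); specialize (H2 n ltac:(lia)).
  replace (psum (fun n => u n - k * v n)%C n) with (psum u n - k * psum v n)%C.
  - replace (_ - _)%C with ((l - psum u n) - k * (l' - psum v n))%C by ring.
    eapply Rle_trans; [apply Cmod_triangle_minus|]. rewrite Cmod_mult.
    assert (Cmod k * Cmod (l' - psum v n) <= (Cmod k + 1) * (eps / (2 * (Cmod k + 1)))).
    { apply Rmult_le_compat; try lra. apply Cmod_ge_0. }
    replace ((Cmod k + 1) * (eps / (2 * (Cmod k + 1)))) with (eps / 2) in H by (field; lra). lra.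
  - clear; induction n as [|n IH]; simpl; [ring|]. rewrite <- IH; ring.
Qed.

Lemma is_csum_ext (u v : nat -> C) (l : C) : (forall n, u n = v n) -> is_csum u l -> is_csum v l.
Proof.
  intros H Hu eps Heps; destruct (Hu eps Heps) as [N0 HN]; exists N0; intros n Hn.
  replace (psum v n) with (psum u n); [auto|].
  clear -H; induction n as [|n IH]; simpl; [reflexivity|]. rewrite IH, H; reflexivity.
Qed.

Lemma is_csum_scal (u : nat -> C) (l k : C) : is_csum u l ->
  is_csum (fun n => k * u n)%C (k * l)%C.
Proof.
  intros H. replace (k * l)%C with (0 - (- k) * l)%C by ring.
  eapply is_csum_ext; [|apply (is_csum_lin (fun _ => 0%C) u 0%C l (- k)%C); [|exact H]].
  - intros n; simpl; ring.
  - intros eps Heps; exists O; intros n _.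
    assert (E : psum (fun _ => RtoC 0) n = RtoC 0)
      by (clear; induction n as [|n IH]; simpl; [reflexivity|]; rewrite IH; ring).
    rewrite E; replace (0 - 0)%C with (RtoC 0) by ring; rewrite Cmod_0; lra.
Qed.

(** Dominated convergence for series.  The predicate [near d] stands for a
    neighbourhood basis and [nu] for the size of the increment; the same
    statement then gives the derivative of a sum on the half-line, uniform
    continuity of the sum of the derivatives, complex differentiability of the
    sum of the transforms, and convergence of the Laplace integral of the sum.
    The domination is required only for large indices, since finitely many
    terms are controlled by their own convergence. *)
Lemma tannery (X : Type) (near : R -> X -> Prop) (nu : X -> R) (Phi : nat -> X -> C)
    (Psi : X -> C) (a c : nat -> R) (K d0 : R) (N0 : nat) :
  (forall d d' x, d <= d' -> near d x -> near d' x) ->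
  (forall x, 0 <= nu x) -> halving c -> (forall n, Rabs (a n) <= c n) -> 0 < d0 -> 0 <= K ->
  (forall n x, (N0 <= n)%nat -> near d0 x -> Cmod (Phi n x) <= K * nu x) ->
  (forall n eps, 0 < eps -> exists d, 0 < d /\ forall x, near d x -> Cmod (Phi n x) <= eps * nu x) ->
  (forall x, near d0 x -> is_csum (fun n => RtoC (a n) * Phi n x)%C (Psi x)) ->
  forall eps, 0 < eps -> exists d, 0 < d /\ forall x, near d x -> Cmod (Psi x) <= eps * nu x.
Proof.
  intros Hmono Hnu Hc Ha Hd0 HK Hdom Hpt Hsum eps Heps.
  destruct (halving_small c Hc (eps / (4 * (K + 1)))) as [N1 HN1]; [apply Rdiv_lt_0_compat; lra|].
  set (N := (N0 + N1)%nat).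
  set (e := eps / (2 * (INR N * c O + 1))).
  assert (Hc0 := proj1 (Hc O)).
  assert (HN := pos_INR N).
  assert (HNc : 0 <= INR N * c O) by (apply Rmult_le_pos; lra).
  assert (He : 0 < e) by (apply Rdiv_lt_0_compat; lra).
  assert (Hfin : forall n, exists d, 0 < d /\ forall x, near d x ->
     Cmod (psum (fun n => RtoC (a n) * Phi n x)%C n) <= INR n * c O * (e * nu x)).
  { induction n as [|n [d1 [Hd1 H1]]].
    - exists 1; split; [lra|]; intros x _; simpl; rewrite Cmod_0; lra.
    - destruct (Hpt n e He) as [d2 [Hd2 H2]].
      exists (Rmin d1 d2); split; [apply Rmin_pos; assumption|]; intros x Hx.
      specialize (H1 x (Hmono _ _ _ (Rmin_l _ _) Hx)).
      specialize (H2 x (Hmono _ _ _ (Rmin_r _ _) Hx)).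
      cbn [psum]; rewrite S_INR; eapply Rle_trans; [apply Cmod_triangle|].
      rewrite Cmod_mult, Cmod_R.
      assert (Rabs (a n) * Cmod (Phi n x) <= c O * (e * nu x)); [|lra].
      apply Rmult_le_compat; [apply Rabs_pos|apply Cmod_ge_0| |exact H2].
      eapply Rle_trans; [apply Ha|apply halving_decr; [exact Hc|lia]]. }
  destruct (Hfin N) as [d1 [Hd1 H1]].
  exists (Rmin d0 d1); split; [apply Rmin_pos; assumption|]; intros x Hx.
  assert (Hx0 := Hmono _ _ _ (Rmin_l _ _) Hx).
  specialize (H1 x (Hmono _ _ _ (Rmin_r _ _) Hx)).
  assert (T := is_csum_bound c (K * nu x) (fun n => RtoC (a n) * Phi n x)%C (Psi x) N Hc).
  lapply T; [clear T; intros T; specialize (T (Hsum x Hx0))|].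
  - replace (Psi x) with (Psi x - psum (fun n => RtoC (a n) * Phi n x)%C N
      + psum (fun n => RtoC (a n) * Phi n x)%C N)%C by ring.
    eapply Rle_trans; [apply Cmod_triangle|].
    assert (G1 : INR N * c O * (e * nu x) <= eps / 2 * nu x).
    { rewrite <- Rmult_assoc; apply Rmult_le_compat_r; [apply Hnu|].
      apply Rle_trans with ((INR N * c O + 1) * e).
      - apply Rmult_le_compat_r; lra.
      - unfold e; right; field; lra. }
    assert (G2 : 2 * c N * (K * nu x) <= eps / 2 * nu x).
    { rewrite <- Rmult_assoc; apply Rmult_le_compat_r; [apply Hnu|].
      specialize (HN1 N ltac:(unfold N; lia)).
      apply Rle_trans with (2 * (eps / (4 * (K + 1))) * (K + 1)).
      - apply Rmult_le_compat; try lra. assert (Q := proj1 (Hc N)); lra.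
      - right; field; lra. }
    lra.
  - intros n Hn; rewrite Cmod_mult, Cmod_R.
    apply Rmult_le_compat; [apply Rabs_pos|apply Cmod_ge_0|apply Ha|].
    apply Hdom; [unfold N in Hn; lia|exact Hx0].
Qed.

(** The real mean value theorem is applied to both components, hence the factor
    two. *)
Lemma mean_value_RC (f g : R -> C) (K : R) :
  (forall t, 0 <= t -> is_derive_RC f t (g t)) ->
  (forall t, 0 <= t -> Cmod (g t) <= K) ->
  forall s t, 0 <= s -> 0 <= t -> Cmod (f s - f t) <= 2 * K * Rabs (s - t).
Proof.
  intros Hf Hg.
  assert (Q : forall s t, 0 <= s -> s <= t -> Cmod (f t - f s) <= 2 * K * (t - s)).
  { intros s t Hs Hst.
    eapply Rle_trans; [apply Cmod_le_abs|].
    destruct (MVT_gen (fun s => Re (f s)) s t (fun s => Re (g s))) as [x [Hx Ex]].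
    - intros x Hx; rewrite Rmin_left, Rmax_right in Hx by lra; apply Hf; lra.
    - intros x Hx; rewrite Rmin_left, Rmax_right in Hx by lra.
      apply continuity_pt_filterlim.
      apply (ex_derive_continuous (K := R_AbsRing) (V := R_NormedModule)).
      eexists; apply (proj1 (Hf x ltac:(lra))).
    - destruct (MVT_gen (fun s => Im (f s)) s t (fun s => Im (g s))) as [y [Hy Ey]].
      + intros y Hy; rewrite Rmin_left, Rmax_right in Hy by lra; apply Hf; lra.
      + intros y Hy; rewrite Rmin_left, Rmax_right in Hy by lra.
        apply continuity_pt_filterlim.
        apply (ex_derive_continuous (K := R_AbsRing) (V := R_NormedModule)).
        eexists; apply (proj2 (Hf y ltac:(lra))).
      + rewrite Rmin_left, Rmax_right in Hx, Hy by lra.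
        change (Rabs (Re (f t) - Re (f s)) + Rabs (Im (f t) - Im (f s)) <= 2 * K * (t - s)).
        rewrite Ex, Ey, !Rabs_mult, !(Rabs_pos_eq (t - s)) by lra.
        assert (G1 := Rle_trans _ _ _ (re_le_Cmod (g x)) (Hg x ltac:(lra))).
        assert (G2 := Rle_trans _ _ _ (im_le_Cmod (g y)) (Hg y ltac:(lra))).
        nra. }
  intros s t Hs Ht; destruct (Rle_dec s t).
  - rewrite Cmod_minus_sym, Rabs_minus_sym, (Rabs_pos_eq (t - s)) by lra; apply Q; lra.
  - rewrite (Rabs_pos_eq (s - t)) by lra; apply Q; lra.
Qed.

(** * Superposition of test functions and the gliding hump *)

(** What is needed of a test function [f] with derivative [g] and continued
    transform [F] for infinite sums of such functions to belong again to the class.  The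
    constant [K] has to be common to the whole family.  The Lipschitz bound on
    [F] holds only in the strip of half-width [L], but for families with [L]
    tending to infinity it is eventually available near every point: it
    dominates the difference quotients and makes sums of transforms analytic
    without Cauchy estimates. *)
Record atom (M : R -> R) (w : C -> C) (K L : R) (f g : R -> C) (F : C -> C) : Prop := {
  atom_bounded : forall t, 0 <= t -> Cmod (f t) <= K;
  atom_derive : forall t, is_derive_RC f t (g t);
  atom_derive_bounded : forall t, 0 <= t -> Cmod (g t) <= K;
  atom_derive_uc : exists k, 0 <= k /\ forall s t, 0 <= s -> 0 <= t ->
    Cmod (g s - g t)%C <= k * Rabs (s - t);
  atom_analytic : analytic_on (Omega M) F;
  atom_laplace : forall z, 0 < Re z ->
    is_RInt_gen (V := C_R_NormedModule) (fun t : R => (Cexp (- (z * RtoC t)) * f t)%C)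
      (at_point 0) (Rbar_locally p_infty) (F z);
  atom_growth : forall z, Omega M z -> Cmod (F z) <= K * M (Rabs (Im z));
  atom_weight : forall z, Omega M z -> Cmod (w z * F z)%C <= K * M (Rabs (Im z));
  atom_lipschitz : forall z z', Rabs (Im z) <= L -> Rabs (Im z') <= L ->
    Cmod (F z - F z')%C <= K * Cmod (z - z')%C }.

Arguments atom_bounded {M w K L f g F}.
Arguments atom_derive {M w K L f g F}.
Arguments atom_derive_bounded {M w K L f g F}.
Arguments atom_derive_uc {M w K L f g F}.
Arguments atom_analytic {M w K L f g F}.
Arguments atom_laplace {M w K L f g F}.
Arguments atom_growth {M w K L f g F}.
Arguments atom_weight {M w K L f g F}.
Arguments atom_lipschitz {M w K L f g F}.

Lemma csum_choice (X : Type) (u : X -> nat -> C) :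
  exists G : X -> C, forall x, (exists l, is_csum (u x) l) -> is_csum (u x) (G x).
Proof.
  apply (functional_choice (fun x l => (exists l, is_csum (u x) l) -> is_csum (u x) l)).
  intros x; destruct (classic (exists l, is_csum (u x) l)) as [[l Hl]|H].
  - exists l; auto.
  - exists 0%C; tauto.
Qed.

Lemma continuous_of_lipschitz (f : R -> R) (k : R) : 0 <= k ->
  (forall s t, Rabs (f s - f t) <= k * Rabs (s - t)) -> forall t, continuous f t.
Proof.
  intros Hk H t.
  apply continuity_pt_filterlim. intros eps Heps.
  exists (eps / (k + 1)); split; [apply Rdiv_lt_0_compat; lra|].
  intros s [_ Hs]. simpl in *; unfold Rdist in *.
  eapply Rle_lt_trans; [apply H|].
  apply Rle_lt_trans with ((k + 1) * Rabs (s - t)).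
  - apply Rmult_le_compat_r; [apply Rabs_pos|lra].
  - apply Rmult_lt_compat_l with (r := k + 1) in Hs; [|lra].
    replace ((k + 1) * (eps / (k + 1))) with eps in Hs by (field; lra). exact Hs.
Qed.

(** Only the values on the half-line are controlled, so the integrand is replaced
    by its even extension, which is continuous on both sides of [0]. *)
Lemma ex_laplace_partial (f : R -> C) (k : R) (z : C) : 0 <= k ->
  (forall s t, 0 <= s -> 0 <= t -> Cmod (f s - f t)%C <= k * Rabs (s - t)) ->
  exists I : R -> C, forall T, 0 <= T -> is_RInt (V := C_R_NormedModule)
    (fun t : R => (Cexp (- (z * RtoC t)) * f t)%C) 0 T (I T).
Proof.
  intros Hk H.
  assert (H' : forall s t, Cmod (f (Rabs s) - f (Rabs t))%C <= k * Rabs (s - t)).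
  { intros s t; eapply Rle_trans; [apply H; apply Rabs_pos|].
    apply Rmult_le_compat_l; [exact Hk|apply Rabs_triang_inv2]. }
  assert (Cre : forall t, continuous (fun s => Re (f (Rabs s))) t).
  { apply (continuous_of_lipschitz _ k Hk); intros s t; eapply Rle_trans; [|apply H'].
    change (Rabs (Re (f (Rabs s) - f (Rabs t))%C) <= Cmod (f (Rabs s) - f (Rabs t))%C).
    apply re_le_Cmod. }
  assert (Cim : forall t, continuous (fun s => Im (f (Rabs s))) t).
  { apply (continuous_of_lipschitz _ k Hk); intros s t; eapply Rle_trans; [|apply H'].
    change (Rabs (Im (f (Rabs s) - f (Rabs t))%C) <= Cmod (f (Rabs s) - f (Rabs t))%C).
    apply im_le_Cmod. }
  destruct z as [x y].
  assert (Ce : forall t, continuous (fun s => exp (- x * s) * cos (y * s)) t).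
  { intros t; apply (ex_derive_continuous (K := R_AbsRing) (V := R_NormedModule)).
    auto_derive; exact I. }
  assert (Cs : forall t, continuous (fun s => exp (- x * s) * sin (y * s)) t).
  { intros t; apply (ex_derive_continuous (K := R_AbsRing) (V := R_NormedModule)).
    auto_derive; exact I. }
  set (fr := fun s => exp (- x * s) * cos (y * s) * Re (f (Rabs s)) +
                      exp (- x * s) * sin (y * s) * Im (f (Rabs s))).
  set (fi := fun s => exp (- x * s) * cos (y * s) * Im (f (Rabs s)) -
                      exp (- x * s) * sin (y * s) * Re (f (Rabs s))).
  assert (E : forall s, 0 <= s -> (Cexp (- ((x, y) * RtoC s)) * f s)%C = (fr s, fi s)).
  { intros s Hs; unfold fr, fi; rewrite (Rabs_pos_eq s Hs).
    apply injective_projections; unfold Cexp; simpl.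
    - replace (- (x * s - y * 0)) with (- x * s) by ring.
      replace (- (x * 0 + y * s)) with (- (y * s)) by ring.
      rewrite cos_neg, sin_neg; unfold Re, Im; ring.
    - replace (- (x * s - y * 0)) with (- x * s) by ring.
      replace (- (x * 0 + y * s)) with (- (y * s)) by ring.
      rewrite cos_neg, sin_neg; unfold Re, Im; ring. }
  exists (fun T => (RInt fr 0 T, RInt fi 0 T)); intros T HT.
  apply (is_RInt_ext (V := C_R_NormedModule) (fun s => (fr s, fi s))).
  { intros s Hs; rewrite Rmin_left in Hs by lra; symmetry; apply E; lra. }
  apply (is_RInt_fct_extend_pair (U := R_NormedModule) (V := R_NormedModule));
    apply (RInt_correct (V := R_CompleteNormedModule)),
      (ex_RInt_continuous (V := R_CompleteNormedModule)); intros s _.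
  - apply (continuous_plus (V := R_NormedModule));
      apply (continuous_mult (K := R_AbsRing)); auto.
  - apply (continuous_minus (V := R_NormedModule));
      apply (continuous_mult (K := R_AbsRing)); auto.
Qed.

Lemma Cmod_laplace_partial (f : R -> C) (z : C) (K T : R) (I : C) : 0 < Re z -> 0 <= T ->
  (forall t, 0 <= t -> Cmod (f t) <= K) ->
  is_RInt (V := C_R_NormedModule) (fun t : R => (Cexp (- (z * RtoC t)) * f t)%C) 0 T I ->
  Cmod I <= K / Re z.
Proof.
  intros Hz HT HK HI.
  assert (K0 : 0 <= K) by (eapply Rle_trans; [apply Cmod_ge_0|apply (HK 0); lra]).
  eapply Rle_trans;
    [apply (Cmod_RInt_le (fun t : R => (Cexp (- (z * RtoC t)) * f t)%C)
       (fun t => K * exp (- Re z * t)) 0 T I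
       ((- (K / Re z) * exp (- Re z * T)) - (- (K / Re z) * exp (- Re z * 0))) HT)|].
  - intros t Ht; rewrite Cmod_mult, Cmod_Cexp.
    replace (Re (- (z * RtoC t))%C) with (- Re z * t) by (destruct z; simpl; ring).
    rewrite Rmult_comm; apply Rmult_le_compat_r; [left; apply exp_pos|apply HK; lra].
  - exact HI.
  - apply (is_RInt_derive (V := R_CompleteNormedModule) (fun t => - (K / Re z) * exp (- Re z * t))).
    + intros t _; auto_derive; [trivial|field; lra].
    + intros t _. apply (ex_derive_continuous (K := R_AbsRing) (V := R_NormedModule)).
      auto_derive; trivial.
  - rewrite Rmult_0_r, exp_0.
    assert (0 <= K / Re z * exp (- Re z * T)); [|lra].
    apply Rmult_le_pos; [apply Rdiv_le_0_compat; lra|left; apply exp_pos].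
Qed.

Lemma is_RInt_RC_unique (f : R -> C) (a b : R) (I J : C) :
  is_RInt (V := C_R_NormedModule) f a b I -> is_RInt (V := C_R_NormedModule) f a b J -> I = J.
Proof.
  intros HI HJ.
  rewrite <- (is_RInt_unique (V := C_R_CompleteNormedModule) f a b I HI).
  apply (is_RInt_unique (V := C_R_CompleteNormedModule) f a b J HJ).
Qed.

Lemma is_RInt_psum (f : nat -> R -> C) (a : nat -> R) (e : R -> C) (I : nat -> C) (T : R) :
  (forall n, is_RInt (V := C_R_NormedModule) (fun t => e t * f n t)%C 0 T (I n)) ->
  forall n, is_RInt (V := C_R_NormedModule)
    (fun t => e t * psum (fun k => RtoC (a k) * f k t)%C n)%C 0 T
    (psum (fun k => RtoC (a k) * I k)%C n).
Proof.
  intros H n; induction n as [|n IH]; simpl.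
  - apply (is_RInt_ext (V := C_R_NormedModule) (fun _ => RtoC 0)).
    { intros t _; change (RtoC 0 = (e t * 0)%C); ring. }
    assert (E0 : scal (V := C_R_NormedModule) (T - 0) (RtoC 0) = RtoC 0).
    2:{ assert (Q := is_RInt_const (V := C_R_NormedModule) 0 T (RtoC 0)).
        exact (eq_ind _ (is_RInt (V := C_R_NormedModule) (fun _ => RtoC 0) 0 T) Q _ E0). }
    apply injective_projections; simpl; unfold scal; simpl; unfold mult; simpl; ring.
  - assert (E : forall (k : R) (v : C), scal (V := C_R_NormedModule) k v = (RtoC k * v)%C).
    { intros k v; apply injective_projections; simpl; unfold scal; simpl; unfold mult; simpl; ring. }
    assert (G := is_RInt_plus (V := C_R_NormedModule) _ _ _ _ _ _ IH
      (is_RInt_scal (V := C_R_NormedModule) _ _ _ (a n) _ (H n))).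
    rewrite E in G.
    eapply is_RInt_ext; [|exact G].
    intros t _; simpl. rewrite E.
    change ((e t * psum (fun k => RtoC (a k) * f k t) n + RtoC (a n) * (e t * f n t))%C =
      (e t * (psum (fun k => RtoC (a k) * f k t) n + RtoC (a n) * f n t))%C). ring.
Qed.

Lemma laplace_unique (f : R -> C) (z l : C) :
  is_RInt_gen (V := C_R_NormedModule) (fun t : R => (Cexp (- (z * RtoC t)) * f t)%C)
    (at_point 0) (Rbar_locally p_infty) l -> laplace f z = l.
Proof. intros H; exact (is_RInt_gen_unique (V := C_R_CompleteNormedModule) _ l H). Qed.

Section AtomSum.

Variables (M : R -> R) (w : C -> C) (K : R) (f g : nat -> R -> C) (F : nat -> C -> C).
Variables (a c : nat -> R).
Hypothesis M_pos : forall s, 0 <= s -> 0 < M s.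
Hypothesis K_pos : 0 <= K.
Hypothesis c_halving : halving c.
Hypothesis a_le : forall n, Rabs (a n) <= c n.
Hypothesis atoms : forall n, atom M w K (INR n) (f n) (g n) (F n).

Let term_bound (u : nat -> C) (k : R) (N : nat) :
  (forall n, (N <= n)%nat -> Cmod (u n) <= k) ->
  forall n, (N <= n)%nat -> Cmod (RtoC (a n) * u n)%C <= c n * k.
Proof.
  intros H n Hn; rewrite Cmod_mult, Cmod_R.
  apply Rmult_le_compat; [apply Rabs_pos|apply Cmod_ge_0|apply a_le|apply H, Hn].
Qed.

Let sum_ex (u : nat -> C) (k : R) (N : nat) :
  (forall n, (N <= n)%nat -> Cmod (u n) <= k) -> exists l, is_csum (fun n => RtoC (a n) * u n)%C l.
Proof. intros H; apply (is_csum_ex c k _ N c_halving), term_bound, H. Qed.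

Let sum_bound (u : nat -> C) (k : R) (l : C) :
  (forall n, Cmod (u n) <= k) -> is_csum (fun n => RtoC (a n) * u n)%C l -> Cmod l <= 2 * c O * k.
Proof.
  intros H Hl.
  assert (B := is_csum_bound c k _ l O c_halving (term_bound u k O (fun n _ => H n)) Hl).
  simpl in B; replace (l - 0)%C with l in B by ring; exact B.
Qed.

Let sum_lin (u v : nat -> C) (l l' k : C) :
  is_csum (fun n => RtoC (a n) * u n)%C l -> is_csum (fun n => RtoC (a n) * v n)%C l' ->
  is_csum (fun n => RtoC (a n) * (u n - k * v n))%C (l - k * l')%C.
Proof.
  intros H H'; eapply is_csum_ext; [|apply (is_csum_lin _ _ _ _ k H H')].
  intros n; simpl; ring.
Qed.

Let sum_sub (u v : nat -> C) (l l' : C) :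
  is_csum (fun n => RtoC (a n) * u n)%C l -> is_csum (fun n => RtoC (a n) * v n)%C l' ->
  is_csum (fun n => RtoC (a n) * (u n - v n))%C (l - l')%C.
Proof.
  intros H H'; replace (l - l')%C with (l - 1 * l')%C by ring.
  eapply is_csum_ext; [|apply (sum_lin u v l l' 1 H H')]. intros n; simpl; ring.
Qed.

Let derive_bounded_at (z l : C) (n : nat) : Rabs (Im z) + 1 <= INR n ->
  is_derive (K := C_AbsRing) (V := C_NormedModule) (F n) z l -> Cmod l <= K.
Proof.
  intros Hn Hl; apply le_epsilon; intros eps Heps.
  destruct (is_derive_C_elim _ _ _ Hl eps Heps) as [d [Hd H]].
  set (h := RtoC (d / 2)).
  assert (Hh : Cmod h = d / 2) by (unfold h; rewrite Cmod_R, Rabs_pos_eq; lra).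
  specialize (H h ltac:(lra)).
  assert (Lp := atom_lipschitz (atoms n) (z + h)%C z).
  replace (z + h - z)%C with h in Lp by ring.
  assert (Ei : Im (z + h)%C = Im z) by (unfold h, Im; simpl; ring).
  rewrite Ei in Lp; specialize (Lp ltac:(lra) ltac:(lra)).
  assert (B : Cmod (h * l) <= (K + eps) * Cmod h).
  { replace (h * l)%C with ((F n (z + h)%C - F n z) - (F n (z + h)%C - F n z - h * l))%C by ring.
    eapply Rle_trans; [apply Cmod_triangle_minus|]. lra. }
  rewrite Cmod_mult in B. apply Rmult_le_reg_l with (Cmod h); lra.
Qed.

(** Absolutely convergent sums of test functions stay in the class.  Each
    property is a uniform bound on the tail or an instance of dominated
    convergence. *)
Lemma atom_sum : exists h : R -> C,
  (forall t, 0 <= t -> is_csum (fun n => RtoC (a n) * f n t)%C (h t)) /\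
  bounded_on_Rplus h /\ lipschitz_on_Rplus h /\ has_uniformly_continuous_derivative h /\
  exists G : C -> C, laplace_extends_to M h G /\
    exists k, forall z, Omega M z -> Cmod (w z * G z)%C / M (Rabs (Im z)) <= k.
Proof.
  assert (c0 := proj1 (c_halving O)).
  destruct (csum_choice R (fun t n => RtoC (a n) * f n t)%C) as [h Hh].
  destruct (csum_choice R (fun t n => RtoC (a n) * g n t)%C) as [h' Hh'].
  destruct (csum_choice C (fun z n => RtoC (a n) * F n z)%C) as [G HG].
  assert (Sh : forall t, 0 <= t -> is_csum (fun n => RtoC (a n) * f n t)%C (h t)).
  { intros t Ht; apply Hh, (sum_ex _ K O); intros n _; apply (atom_bounded (atoms n)), Ht. }
  assert (Sh' : forall t, 0 <= t -> is_csum (fun n => RtoC (a n) * g n t)%C (h' t)).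
  { intros t Ht; apply Hh', (sum_ex _ K O); intros n _; apply (atom_derive_bounded (atoms n)), Ht. }
  clear Hh Hh'.
  assert (f_lip : forall n s t, 0 <= s -> 0 <= t ->
     Cmod (f n s - f n t) <= 2 * K * Rabs (s - t)).
  { intros n; apply (mean_value_RC (f n) (g n)).
    - intros t _; apply (atom_derive (atoms n)).
    - apply (atom_derive_bounded (atoms n)). }
  assert (h_lip : forall s t, 0 <= s -> 0 <= t -> Cmod (h s - h t) <= 2 * c O * (2 * K) * Rabs (s - t)).
  { intros s t Hs Ht; rewrite Rmult_assoc.
    apply (sum_bound (fun n => f n s - f n t)%C); [intros n; apply f_lip; assumption|].
    apply sum_sub; auto. }
  assert (h_bd : forall t, 0 <= t -> Cmod (h t) <= 2 * c O * K).
  { intros t Ht; apply (sum_bound (fun n => f n t)); [|auto].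
    intros n; apply (atom_bounded (atoms n)), Ht. }
  exists h; repeat split; [exact Sh|eexists; exact h_bd|eexists; exact h_lip| |].
  - exists h'; split.
    + apply is_derive_on_Rplus_intro; intros t Ht eps Heps.
      destruct (tannery R (fun d s => 0 <= s /\ Rabs (s - t) < d) (fun s => Rabs (s - t))
        (fun n s => f n s - f n t - RtoC (s - t) * g n t)%C
        (fun s => h s - h t - RtoC (s - t) * h' t)%C a c (3 * K) 1 O) with (eps := eps)
        as [d [Hd H]]; auto; try lra.
      * intros d d' s Hdd [H1 H2]; split; lra.
      * intros s; apply Rabs_pos.
      * intros n s _ [Hs _]; eapply Rle_trans; [apply Cmod_triangle_minus|].
        rewrite Cmod_mult, Cmod_R.
        assert (A := f_lip n s t Hs Ht). assert (B := atom_derive_bounded (atoms n) t Ht).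
        assert (D := Rabs_pos (s - t)).
        apply Rmult_le_compat_l with (r := Rabs (s - t)) in B; lra.
      * intros n e He.
        destruct (is_derive_RC_elim _ _ _ (atom_derive (atoms n) t) e He) as [d [Hd H]].
        exists d; split; [exact Hd|]; intros s [_ Hs]; apply H, Hs.
      * intros s [Hs _].
        apply (sum_lin (fun n => f n s - f n t)%C); [apply sum_sub|]; auto.
      * exists d; split; [exact Hd|]; intros s Hs Hst; apply H; auto.
    + intros eps Heps.
      destruct (tannery (R * R) (fun d p => 0 <= fst p /\ 0 <= snd p /\ Rabs (fst p - snd p) < d)
        (fun _ => 1) (fun n p => g n (fst p) - g n (snd p))%C
        (fun p => h' (fst p) - h' (snd p))%C a c (2 * K) 1 O) with (eps := eps / 2)
        as [d [Hd H]]; auto; try lra.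
      * intros d d' p Hdd [H1 [H2 H3]]; repeat split; lra.
      * intros; lra.
      * intros n p _ [H1 [H2 _]]; eapply Rle_trans; [apply Cmod_triangle_minus|].
        assert (A := atom_derive_bounded (atoms n) _ H1).
        assert (B := atom_derive_bounded (atoms n) _ H2). lra.
      * intros n e He; destruct (atom_derive_uc (atoms n)) as [k [Hk H]].
        exists (e / (k + 1)); split; [apply Rdiv_lt_0_compat; lra|].
        intros p [H1 [H2 H3]]; eapply Rle_trans; [apply H; assumption|].
        apply Rle_trans with ((k + 1) * (e / (k + 1))); [|right; field; lra].
        apply Rmult_le_compat; try lra; apply Rabs_pos.
      * intros p [H1 [H2 _]]; apply sum_sub; auto.
      * exists d; split; [exact Hd|]; intros s t Hs Ht Hst.
        specialize (H (s, t) (conj Hs (conj Ht Hst))); simpl in H; lra.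
  - assert (SG : forall z, Omega M z -> is_csum (fun n => RtoC (a n) * F n z)%C (G z)).
    { intros z Hz; apply HG, (sum_ex _ (K * M (Rabs (Im z))) O).
      intros n _; apply (atom_growth (atoms n)), Hz. }
    exists G; split; [split|].
    + intros z Hz.
      (* from index N on, the strip of the n-th transform contains a unit disc at z *)
      destruct (INR_unbounded (Rabs (Im z) + 1)) as [N HN].
      assert (HNn : forall n, (N <= n)%nat -> Rabs (Im z) + 1 <= INR n).
      { intros n Hn; apply le_INR in Hn; lra. }
      destruct (functional_choice (fun n l =>
        is_derive (K := C_AbsRing) (V := C_NormedModule) (F n) z l)) as [l Hl].
      { intros n; destruct (atom_analytic (atoms n) z Hz) as [l Hl]; exists l; exact Hl. }
      assert (Hlb : forall n, (N <= n)%nat -> Cmod (l n) <= K).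
      { intros n Hn; apply (derive_bounded_at z (l n) n); auto. }
      destruct (sum_ex l K N Hlb) as [L HL].
      assert (near : forall n x, (N <= n)%nat -> Cmod x < 1 ->
         Cmod (F n (z + x)%C - F n z) <= K * Cmod x).
      { intros n x Hn Hx. specialize (HNn n Hn).
        assert (B := atom_lipschitz (atoms n) (z + x)%C z).
        replace (z + x - z)%C with x in B by ring. apply B; [|lra].
        assert (T := Rabs_triang (Im z) (Im x)). assert (I := im_le_Cmod x).
        change (Im (z + x)%C) with (Im z + Im x); lra. }
      assert (SGx : forall x, Cmod x < 1 -> is_csum (fun n => RtoC (a n) * F n (z + x)%C)%C (G (z + x)%C)).
      { intros x Hx; apply HG, (sum_ex _ (K * M (Rabs (Im z)) + K) N).
        intros n Hn. replace (F n (z + x)%C) with (F n z + (F n (z + x)%C - F n z))%C by ring.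
        eapply Rle_trans; [apply Cmod_triangle|].
        assert (A := atom_growth (atoms n) z Hz). assert (B := near n x Hn Hx).
        assert (K * Cmod x <= K * 1) by (apply Rmult_le_compat_l; lra). lra. }
      exists L; apply is_derive_C_intro; intros eps Heps.
      destruct (tannery C (fun d x => Cmod x < d) Cmod
        (fun n x => F n (z + x)%C - F n z - x * l n)%C
        (fun x => G (z + x)%C - G z - x * L)%C a c (2 * K) 1 N) with (eps := eps)
        as [d [Hd H]]; auto; try lra.
      * intros d d' x Hdd H; lra.
      * intros x; apply Cmod_ge_0.
      * intros n x Hn Hx; eapply Rle_trans; [apply Cmod_triangle_minus|].
        rewrite Cmod_mult. assert (A := near n x Hn Hx). assert (B := Hlb n Hn).
        apply Rmult_le_compat_l with (r := Cmod x) in B; [lra|apply Cmod_ge_0].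
      * intros n e He; exact (is_derive_C_elim _ _ _ (Hl n) e He).
      * exists d; auto.
    + intros z Hz; symmetry.
      assert (HzO : Omega M z).
      { unfold Omega. assert (P := M_pos (Rabs (Im z)) (Rabs_pos _)).
        assert (0 < 1 / M (Rabs (Im z))) by (apply Rdiv_lt_0_compat; lra). lra. }
      apply laplace_unique.
      destruct (ex_laplace_partial h (2 * c O * (2 * K)) z) as [I HI]; [nra|exact h_lip|].
      destruct (functional_choice (fun n (I : R -> C) => forall T, 0 <= T ->
        is_RInt (V := C_R_NormedModule) (fun t : R => (Cexp (- (z * RtoC t)) * f n t)%C) 0 T (I T)))
        as [J HJ].
      { intros n; apply (ex_laplace_partial (f n) (2 * K) z); [lra|apply f_lip]. }
      apply (is_RInt_gen_0_infty_intro _ I _ HI); intros eps Heps.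
      destruct (tannery R (fun d T => 0 <= T /\ 1 <= d * T) (fun _ => 1)
        (fun n T => J n T - F n z)%C (fun T => I T - G z)%C a c
        (K / Re z + K * M (Rabs (Im z))) 1 O) with (eps := eps) as [d [Hd H]]; auto; try lra.
      * intros d d' T Hdd [H1 H2]; split; [exact H1|]. 
        apply Rmult_le_compat_r with (r := T) in Hdd; lra.
      * intros; lra.
      * assert (A := M_pos (Rabs (Im z)) (Rabs_pos _)).
        assert (0 <= K / Re z) by (apply Rdiv_le_0_compat; lra). nra.
      * intros n T _ [HT _]; rewrite Rmult_1_r.
        eapply Rle_trans; [apply Cmod_triangle_minus|]. apply Rplus_le_compat.
        -- apply (Cmod_laplace_partial (f n) z K T _ Hz HT); [|auto].
           apply (atom_bounded (atoms n)).
        -- apply (atom_growth (atoms n)), HzO.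
      * intros n e He.
        destruct (is_RInt_gen_0_infty_elim _ _ (atom_laplace (atoms n) z Hz) e He) as [T0 HT0].
        exists (/ (Rmax T0 1)).
        assert (A := Rmax_l T0 1). assert (B := Rmax_r T0 1).
        split; [apply Rinv_0_lt_compat; lra|]. intros T [HT H1]; rewrite Rmult_1_r.
        destruct (HT0 T) as [I' [HI' E]].
        { apply Rmult_le_compat_l with (r := Rmax T0 1) in H1; [|lra].
          rewrite <- Rmult_assoc, Rinv_r in H1 by lra. lra. }
        rewrite (is_RInt_RC_unique _ _ _ _ _ (HJ n T HT) HI'); exact E.
      * intros T [HT _]; apply sum_sub; [|auto].
        intros e He.
        destruct (halving_small c c_halving (e / ((2 * K + 1) * (T + 1)))) as [N0 HN0].
        { apply Rdiv_lt_0_compat; [lra|apply Rmult_lt_0_compat; lra]. }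
        exists N0; intros N HN; specialize (HN0 N HN).
        assert (D := is_RInt_minus (V := C_R_NormedModule) _ _ _ _ _ _ (HI T HT)
           (is_RInt_psum f a (fun t => Cexp (- (z * RtoC t))) (fun n => J n T) T (fun n => HJ n T HT) N)).
        assert (cN := proj1 (c_halving N)).
        eapply Rle_trans; [apply (Cmod_RInt_le _ (fun _ => 2 * c N * K) 0 T _
          ((T - 0) * (2 * c N * K)) HT) with (2 := D)|].
        -- intros t Ht; cbv beta.
           change (Cmod (Cexp (- (z * RtoC t)) * h t - Cexp (- (z * RtoC t)) *
             psum (fun k => RtoC (a k) * f k t) N)%C <= 2 * c N * K).
           replace (Cexp (- (z * RtoC t)) * h t - Cexp (- (z * RtoC t)) *
             psum (fun k => RtoC (a k) * f k t) N)%C with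
             (Cexp (- (z * RtoC t)) * (h t - psum (fun k => RtoC (a k) * f k t) N))%C by ring.
           rewrite Cmod_mult, Cmod_Cexp.
           replace (Re (- (z * RtoC t))%C) with (- (Re z * t)) by (destruct z; simpl; ring).
           assert (exp (- (Re z * t)) <= 1).
           { rewrite <- exp_0.
             assert (Q : 0 <= Re z * t) by (apply Rmult_le_pos; lra).
             destruct Q as [Q|Q]; [left; apply exp_increasing; lra|rewrite <- Q, Ropp_0; apply Rle_refl]. }
           assert (B : Cmod (h t - psum (fun k => RtoC (a k) * f k t)%C N) <= 2 * c N * K).
           { apply (is_csum_bound c K); [exact c_halving| |apply Sh; lra].
             apply (term_bound (fun n => f n t)). intros n _; apply (atom_bounded (atoms n)); lra. }
           rewrite <- (Rmult_1_l (2 * c N * K)). apply Rmult_le_compat; auto.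
           ++ left; apply exp_pos.
           ++ apply Cmod_ge_0.
        -- apply (is_RInt_const (V := R_NormedModule)).
        -- apply Rle_trans with ((T + 1) * ((2 * K + 1) * (e / ((2 * K + 1) * (T + 1))))).
           ++ apply Rmult_le_compat; [lra|apply Rmult_le_pos; lra|lra|].
              apply Rle_trans with ((2 * K + 1) * c N); [lra|]. apply Rmult_le_compat_l; lra.
           ++ right; field; split; lra.
      * exists (/ d); intros T HT; specialize (H T).
        assert (0 < / d) by (apply Rinv_0_lt_compat; lra).
        rewrite Rmult_1_r in H; apply H; split; [lra|].
        apply Rmult_le_compat_l with (r := d) in HT; [|lra]. rewrite Rinv_r in HT by lra; exact HT.
    + exists (2 * c O * K); intros z Hz.
      assert (P := M_pos (Rabs (Im z)) (Rabs_pos _)).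
      apply Rmult_le_reg_r with (M (Rabs (Im z))); [exact P|].
      unfold Rdiv; rewrite Rmult_assoc, Rinv_l, Rmult_1_r by lra.
      rewrite Rmult_assoc; apply (sum_bound (fun n => w z * F n z)%C).
      * intros n; apply (atom_weight (atoms n)), Hz.
      * eapply is_csum_ext; [|apply (is_csum_scal _ _ (w z) (SG z Hz))]. intros n; simpl; ring.
Qed.

End AtomSum.

(** This is what makes the choice of signs in the gliding hump possible. *)
Lemma Cmod_add_or_sub (x y : C) : Cmod y <= Cmod (x + y) \/ Cmod y <= Cmod (x - y).
Proof.
  assert (H : 2 * Cmod y <= Cmod (x + y) + Cmod (x - y)).
  { replace (2 * Cmod y) with (Cmod (RtoC 2 * y)%C)
      by (rewrite Cmod_mult, Cmod_R, Rabs_pos_eq; lra).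
    replace (RtoC 2 * y)%C with ((x + y) - (x - y))%C.
    - apply Cmod_triangle_minus.
    - replace 2 with (1 + 1) by lra. rewrite RtoC_plus; ring. }
  destruct (Rle_dec (Cmod y) (Cmod (x + y))); [left|right]; lra.
Qed.

(** If [r] is not [O(rho)], a function violating the decay rate [1/r] is built as
    a sum of test functions [f_n] peaking at times [t_n].  Once the coefficient
    [c_n] is known, [t_n] is chosen so late that [r (t_n)] exceeds [rho (t_n)]
    by the factor [2 (n + 1) / c_n]; then [c_(n+1)] is taken so small that all
    later terms together spoil at most half of [c_n |f_n (t_n)|].  Earlier terms
    cannot cancel the peak because the sign of the new term is chosen in view of
    the partial sum already present. *)
Lemma gliding_hump (M r rho : R -> R) (w : C -> C) (K : R) :
  (forall s, 0 <= s -> 0 < M s) -> (forall s, 0 <= s -> 0 < r s) -> 0 < K ->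
  (forall L, exists T, forall t, T <= t -> exists f g F,
     atom M w K L f g F /\ 1 <= Cmod (f t) * rho t) ->
  (forall f : R -> C, bounded_on_Rplus f -> lipschitz_on_Rplus f ->
     has_uniformly_continuous_derivative f ->
     (exists F, laplace_extends_to M f F /\
        exists k, forall z, Omega M z -> Cmod (w z * F z)%C / M (Rabs (Im z)) <= k) ->
     bigO_infty (fun t => Cmod (f t)) (fun t => / r t)) ->
  bigO_infty r rho.
Proof.
  intros M_pos r_pos HK Hatoms Hdecay.
  apply NNPP; intros Hnot.
  assert (Hbig : forall k T, exists t, T <= t /\ k * Rabs (rho t) < Rabs (r t)).
  { intros k T; apply NNPP; intros H; apply Hnot; exists k, T; intros t Ht.
    apply Rnot_lt_le; intros Hlt; apply H; exists t; auto. }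
  clear Hnot.
  destruct (functional_choice (fun (p : R * nat) (d : R * ((R -> C) * (R -> C) * (C -> C))) =>
    0 < fst p ->
    INR (snd p) <= fst d /\ 0 < rho (fst d) /\
    2 * (INR (snd p) + 1) / fst p * rho (fst d) < r (fst d) /\
    atom M w K (INR (snd p)) (fst (fst (snd d))) (snd (fst (snd d))) (snd (snd d)) /\
    1 <= Cmod (fst (fst (snd d)) (fst d)) * rho (fst d))) as [pick Hpick].
  { intros [c n]; simpl.
    destruct (Rlt_dec 0 c) as [Hc|Hc]; [|exists (0, (RtoC, RtoC, fun z : C => z)); tauto].
    destruct (Hatoms (INR n)) as [T HT].
    destruct (Hbig (2 * (INR n + 1) / c) (Rmax T (INR n))) as [t [Ht Hr]].
    assert (A := Rmax_l T (INR n)); assert (B := Rmax_r T (INR n)); assert (N := pos_INR n).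
    destruct (HT t ltac:(lra)) as [f [g [F [Hat H1]]]].
    assert (Hrho : 0 < rho t).
    { apply Rnot_le_lt; intros Hle. assert (Q := Cmod_ge_0 (f t)). nra. }
    exists (t, (f, g, F)); simpl; intros _.
    split; [lra|split; [exact Hrho|split; [|split; [exact Hat|exact H1]]]].
    rewrite (Rabs_pos_eq (rho t)), (Rabs_pos_eq (r t)) in Hr; [exact Hr| |lra].
    left; apply r_pos; lra. }
  set (tm := fun c n => fst (pick (c, n))).
  set (fm := fun c n => fst (fst (snd (pick (c, n))))).
  set (gm := fun c n => snd (fst (snd (pick (c, n))))).
  set (Fm := fun c n => snd (snd (pick (c, n)))).
  assert (Hp : forall c n, 0 < c -> INR n <= tm c n /\ 0 < rho (tm c n) /\
    2 * (INR n + 1) / c * rho (tm c n) < r (tm c n) /\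
    atom M w K (INR n) (fm c n) (gm c n) (Fm c n) /\
    1 <= Cmod (fm c n (tm c n)) * rho (tm c n)).
  { intros c n Hc; exact (Hpick (c, n) Hc). }
  clearbody tm fm gm Fm; clear pick Hpick Hatoms Hbig.
  (* the second argument of the minimum bounds the tail at t n by half a peak *)
  set (c := fix c n := match n with
    | O => 1
    | S k => Rmin (c k / 2) (c k * Cmod (fm (c k) k (tm (c k) k)) / (4 * K)) end).
  assert (c_pos : forall n, 0 < c n).
  { induction n as [|n IH]; [simpl; lra|].
    destruct (Hp (c n) n IH) as (_ & H2 & _ & _ & H5).
    change (0 < Rmin (c n / 2) (c n * Cmod (fm (c n) n (tm (c n) n)) / (4 * K))).
    apply Rmin_pos; [lra|]. apply Rdiv_lt_0_compat; [|lra]. apply Rmult_lt_0_compat; [exact IH|].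
    apply Rnot_le_lt; intros Hle. nra. }
  assert (Hc : halving c).
  { intros n; split; [apply c_pos|]. apply Rmin_l. }
  assert (Hc2 : forall n, c (S n) <= c n * Cmod (fm (c n) n (tm (c n) n)) / (4 * K)).
  { intros n; apply Rmin_r. }
  set (t := fun n => tm (c n) n). set (f := fun n => fm (c n) n).
  set (g := fun n => gm (c n) n). set (F := fun n => Fm (c n) n).
  assert (H : forall n, INR n <= t n /\ 0 < rho (t n) /\
    2 * (INR n + 1) / c n * rho (t n) < r (t n) /\
    atom M w K (INR n) (f n) (g n) (F n) /\ 1 <= Cmod (f n (t n)) * rho (t n)).
  { intros n; apply (Hp (c n) n (c_pos n)). }
  change (forall n, c (S n) <= c n * Cmod (f n (t n)) / (4 * K)) in Hc2.
  clearbody t f g F c; clear Hp tm fm gm Fm.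
  (* the sign of the n-th term prevents cancellation at t n with the partial sum x *)
  set (sgn := fun (n : nat) (x : C) => if Rle_dec (Cmod (RtoC (c n) * f n (t n)))
      (Cmod (x + RtoC (c n) * f n (t n))) then c n else - c n).
  set (S := fix S n : R -> C := match n with
    | O => fun _ => 0%C
    | Datatypes.S k => fun s => (S k s + RtoC (sgn k (S k (t k))) * f k s)%C end).
  set (a := fun n => sgn n (S n (t n))).
  assert (Ha : forall n, Rabs (a n) <= c n).
  { intros n; unfold a, sgn; specialize (c_pos n); destruct Rle_dec;
      [rewrite Rabs_pos_eq|rewrite Rabs_left]; lra. }
  assert (HS : forall n s, S n s = psum (fun k => RtoC (a k) * f k s)%C n).
  { induction n as [|n IH]; intros s; [reflexivity|].
    cbn [psum]; rewrite <- IH; reflexivity. }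
  assert (Hlow : forall n, c n * Cmod (f n (t n)) <=
      Cmod (psum (fun k => RtoC (a k) * f k (t n))%C (Datatypes.S n))).
  { intros n; cbn [psum]; rewrite <- HS.
    replace (c n * Cmod (f n (t n))) with (Cmod (RtoC (c n) * f n (t n))%C)
      by (rewrite Cmod_mult, Cmod_R, Rabs_pos_eq; [reflexivity|left; apply c_pos]).
    unfold a, sgn; destruct Rle_dec as [h|h]; [exact h|].
    destruct (Cmod_add_or_sub (S n (t n)) (RtoC (c n) * f n (t n))) as [h'|h']; [contradiction|].
    replace (S n (t n) + RtoC (- c n) * f n (t n))%C with
      (S n (t n) - RtoC (c n) * f n (t n))%C by (rewrite RtoC_opp; ring). exact h'. }
  clearbody a; clear S sgn HS.
  destruct (atom_sum M w K f g F a c M_pos (Rlt_le _ _ HK) Hc Ha) as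
    (h & Sh & Hb & Hl & Hu & HF).
  { intros n; apply H. }
  destruct (Hdecay h Hb Hl Hu HF) as [k [T HT]].
  destruct (INR_unbounded (Rmax T (Rabs k))) as [n Hn].
  assert (A := Rmax_l T (Rabs k)); assert (B := Rmax_r T (Rabs k)).
  destruct (H n) as (H1 & H2 & H3 & H4 & H5).
  assert (Hn0 := pos_INR n).
  specialize (HT (t n) ltac:(lra)).
  rewrite (Rabs_pos_eq (Cmod _)) in HT by apply Cmod_ge_0.
  assert (Hr := r_pos (t n) ltac:(lra)).
  rewrite Rabs_pos_eq in HT by (left; apply Rinv_0_lt_compat, Hr).
  assert (HT' : Cmod (h (t n)) * r (t n) <= k).
  { apply Rmult_le_compat_r with (r := r (t n)) in HT; [|lra].
    rewrite Rmult_assoc, Rinv_l, Rmult_1_r in HT by lra; exact HT. }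
  assert (Hcn := c_pos n).
  assert (Hh : c n * Cmod (f n (t n)) / 2 <= Cmod (h (t n))).
  { assert (E : Cmod (h (t n) - psum (fun k => RtoC (a k) * f k (t n))%C (S n)) <= 2 * c (S n) * K).
    { apply (is_csum_bound c K); [exact Hc| |apply Sh; lra].
      intros m _; rewrite Cmod_mult, Cmod_R.
      apply Rmult_le_compat; [apply Rabs_pos|apply Cmod_ge_0|apply Ha|].
      apply (atom_bounded (proj1 (proj2 (proj2 (proj2 (H m)))))); lra. }
    assert (E2 : 2 * c (S n) * K <= c n * Cmod (f n (t n)) / 2).
    { specialize (Hc2 n).
      apply Rmult_le_compat_r with (r := 2 * K) in Hc2; [|lra].
      replace (c n * Cmod (f n (t n)) / (4 * K) * (2 * K)) with (c n * Cmod (f n (t n)) / 2)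
        in Hc2 by (field; lra). lra. }
    specialize (Hlow n).
    assert (E3 : Cmod (psum (fun k => RtoC (a k) * f k (t n))%C (S n)) <=
      Cmod (h (t n)) + Cmod (h (t n) - psum (fun k => RtoC (a k) * f k (t n))%C (S n))).
    { replace (psum (fun k => RtoC (a k) * f k (t n))%C (S n)) with
        (h (t n) - (h (t n) - psum (fun k => RtoC (a k) * f k (t n))%C (S n)))%C at 1 by ring.
      apply Cmod_triangle_minus. }
    lra. }
  assert (Hf0 := Cmod_ge_0 (f n (t n))).
  assert (E : INR n + 1 <= Cmod (h (t n)) * r (t n)).
  { apply Rle_trans with (c n * Cmod (f n (t n)) / 2 * (2 * (INR n + 1) / c n * rho (t n))).
    - replace (c n * Cmod (f n (t n)) / 2 * (2 * (INR n + 1) / c n * rho (t n))) with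
        ((INR n + 1) * (Cmod (f n (t n)) * rho (t n))) by (field; lra). nra.
    - apply Rmult_le_compat; try lra.
      + assert (0 <= c n * Cmod (f n (t n))) by (apply Rmult_le_pos; lra). lra.
      + apply Rmult_le_pos; [|lra]. apply Rdiv_le_0_compat; lra. }
  assert (Q := Rle_abs k). lra.
Qed.

(** * Wave packets built from Dirichlet kernels *)

Lemma nat_ceil (x : R) : 0 <= x -> exists n : nat, x <= INR n <= x + 1.
Proof.
  intros Hx; destruct (nfloor_ex x Hx) as [n [H1 H2]]; exists (S n); rewrite S_INR; lra.
Qed.

Lemma exp_le_compat (x y : R) : x <= y -> exp x <= exp y.
Proof. intros [H|H]; [left; apply exp_increasing, H|rewrite H; apply Rle_refl]. Qed.

(** From [1 - cos x = 2 sin^2 (x/2)] and the cubic lower Taylor bound of the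
    sine; the constant is not optimal. *)
Lemma one_minus_cos_ge (x : R) : Rabs x <= 1 -> 32 / 100 * x ^ 2 <= 1 - cos x.
Proof.
  intros Hx.
  assert (S : forall y, 0 <= y -> y <= / 2 -> 9 / 10 * y <= sin y).
  { intros y H0 H1; destruct (pre_sin_bound y 0 H0) as [H _]; [lra|].
    unfold sin_approx, sin_term in H; simpl in H.
    assert (y * y <= / 4) by nra.
    assert (0 <= y * (/ 4 - y * y)) by (apply Rmult_le_pos; lra).
    lra. }
  assert (G : forall y, 0 <= y -> y <= 1 -> 32 / 100 * y ^ 2 <= 1 - cos y).
  { intros y H0 H1; replace (cos y) with (cos (2 * (y / 2))) by (f_equal; lra).
    rewrite cos_2a_sin. specialize (S (y / 2) ltac:(lra) ltac:(lra)).
    assert ((9 / 10 * (y / 2)) * (9 / 10 * (y / 2)) <= sin (y / 2) * sin (y / 2))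
      by (apply Rmult_le_compat; lra).
    nra. }
  destruct (Rle_dec 0 x).
  - rewrite Rabs_pos_eq in Hx by lra; apply G; lra.
  - rewrite Rabs_left in Hx by lra. rewrite <- cos_neg.
    replace (x ^ 2) with ((- x) ^ 2) by ring. apply G; lra.
Qed.

Definition imag (y : R) : C := (0, y).

Definition upper_frequency (mu : C) : Prop := Re mu = 0 /\ 0 <= Im mu.

Fixpoint dirichlet_terms (b eta : R) (N : nat) : list (C * C) :=
  match N with O => nil | S k => (RtoC b, imag (eta * INR k)) :: dirichlet_terms b eta k end.

Lemma dirichlet_terms_frequencies (b eta : R) (N : nat) : 0 <= eta ->
  freqs_in upper_frequency (dirichlet_terms b eta N).
Proof.
  intros He; induction N as [|N IH]; intros p; simpl; [tauto|].
  intros [<- | H]; [|apply IH, H].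
  split; simpl; [reflexivity|apply Rmult_le_pos; [lra|apply pos_INR]].
Qed.

Lemma dirichlet_closed_form (b eta : R) (N : nat) (z : C) :
  ((1 - Cexp (imag eta * z)) * expsum (dirichlet_terms b eta N) z =
   RtoC b * (1 - Cexp (imag (eta * INR N) * z)))%C.
Proof.
  induction N as [|N IH].
  - simpl. replace (imag (eta * 0) * z)%C with (RtoC 0)
      by (apply injective_projections; simpl; ring).
    rewrite Cexp_0; ring.
  - cbn [dirichlet_terms]. unfold expsum; simpl fold_right; fold (expsum (dirichlet_terms b eta N) z).
    rewrite Cmult_plus_distr_l, IH, S_INR.
    replace (imag (eta * (INR N + 1)) * z)%C with
      (imag eta * z + imag (eta * INR N) * z)%C
      by (apply injective_projections; simpl; ring).
    rewrite Cexp_plus; simpl; ring.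
Qed.

Lemma Cmod_Cexp_upper (y : R) (z : C) : 0 <= y -> 0 <= Im z -> Cmod (Cexp (imag y * z)) <= 1.
Proof.
  intros Hy Hz; rewrite Cmod_Cexp, <- exp_0; apply exp_le_compat.
  destruct z; simpl in *; nra.
Qed.

Lemma Cmod_expsum_dirichlet (b eta : R) (N : nat) (z : C) : 0 <= b -> 0 <= eta -> 0 <= Im z ->
  Cmod (expsum (dirichlet_terms b eta N) z) <= b * INR N /\
  Cmod (expsum (expsum_deriv (dirichlet_terms b eta N)) z) <= b * INR N * (eta * INR N).
Proof.
  intros Hb He Hz; induction N as [|N [IH1 IH2]].
  - simpl; rewrite Cmod_0; lra.
  - rewrite S_INR; assert (HN := pos_INR N).
    assert (E := Cmod_Cexp_upper (eta * INR N) z (Rmult_le_pos _ _ He HN) Hz).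
    assert (HeN : 0 <= eta * INR N) by (apply Rmult_le_pos; lra).
    set (X := Cexp (imag (eta * INR N) * z)) in *.
    split; simpl; (eapply Rle_trans; [apply Cmod_triangle|]); fold X.
    + rewrite Cmod_mult, Cmod_R, Rabs_pos_eq by lra.
      assert (b * Cmod X <= b * 1) by (apply Rmult_le_compat_l; lra). lra.
    + rewrite !Cmod_mult, Cmod_R, Rabs_pos_eq by lra.
      replace (Cmod (imag (eta * INR N))) with (eta * INR N).
      * assert (b * (eta * INR N) * Cmod X <= b * (eta * INR N) * 1)
          by (apply Rmult_le_compat_l; [apply Rmult_le_pos; lra|lra]).
        assert (0 <= b * eta) by (apply Rmult_le_pos; lra).
        assert (0 <= b * eta * INR N) by (apply Rmult_le_pos; lra).
        replace (b * (INR N + 1) * (eta * (INR N + 1))) with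
          (b * INR N * (eta * INR N) + 2 * (b * eta * INR N) + b * eta) by ring.
        lra.
      * replace (imag (eta * INR N)) with (RtoC (eta * INR N) * Ci)%C
          by (apply injective_projections; simpl; ring).
        rewrite Cmod_mult, Cmod_Ci, Cmod_R, Rabs_pos_eq; lra.
Qed.

(** With [e = |e^w|] and [k = cos (Im w)], the quantity
    [|1 - e^w|^2 = 1 - 2 e k + e^2] is at least [(1 - k) / 2]: the difference is
    affine in [k], and nonnegative at [k = 1] and [k = -1] for [0 <= e <= 1]. *)
Lemma Cmod_one_minus_Cexp_ge (w : C) : Re w <= 0 -> Rabs (Im w) <= 1 ->
  4 / 10 * Rabs (Im w) <= Cmod (1 - Cexp w).
Proof.
  destruct w as [x y]; simpl Re; simpl Im; intros Hx Hy.
  assert (H := one_minus_cos_ge y Hy).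
  assert (Hc := COS_bound y).
  assert (He : exp x <= 1) by (rewrite <- exp_0; apply exp_le_compat, Hx).
  assert (He0 := exp_pos x).
  assert (Hsc := sin2_cos2 y); unfold Rsqr in Hsc.
  rewrite <- (Rabs_pos_eq (4 / 10)) by lra. rewrite <- Rabs_mult.
  rewrite <- (Rabs_pos_eq (Cmod _)) by apply Cmod_ge_0.
  apply Rsqr_le_abs_0. unfold Rsqr.
  replace (Cmod (1 - Cexp (x, y)) * Cmod (1 - Cexp (x, y))) with (Cmod (1 - Cexp (x, y)) ^ 2) by ring.
  rewrite Cmod2_alt. simpl.
  set (e := exp x) in *; set (k := cos y) in *; set (s := sin y) in *.
  replace ((1 + - (e * k)) * ((1 + - (e * k)) * 1) + (0 + - (e * s)) * ((0 + - (e * s)) * 1))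
    with (1 - 2 * e * k + e * e * (s * s + k * k)) by ring.
  rewrite Hsc.
  assert ((1 - k) / 2 <= 1 - 2 * e * k + e * e * 1); [|nra].
  assert (0 <= (1 - k) * (2 * e)) by (apply Rmult_le_pos; lra).
  assert (A : 0 <= (1 + k) / 2 * ((1 - e) * (1 - e))) by (apply Rmult_le_pos; [lra|apply Rle_0_sqr]).
  assert (B : 0 <= (1 - k) / 2 * (e * (2 + e))) by (apply Rmult_le_pos; [lra|apply Rmult_le_pos; lra]).
  nra.
Qed.

(** A normalised Dirichlet kernel with about [10 t] terms and frequency step
    [1 / (2 t)].  It peaks at [0] with height one, has width of order one and
    bounded frequencies, and its period is long enough for the decay
    [1 / |Re z|] to persist on [-t <= Re z <= 2 t].  All frequencies being
    nonnegative, the bounds hold in the closed upper half-plane. *)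
Lemma dirichlet_kernel (t : R) : 1 <= t -> exists D D' : C -> C,
  is_expsum upper_frequency D D' /\ D 0%C = 1%C /\
  (forall z, 0 <= Im z -> Cmod (D z) <= 1) /\
  (forall z, 0 <= Im z -> Cmod (D' z) <= 6) /\
  (forall z, 0 <= Im z -> - t <= Re z <= 2 * t -> Cmod (D z) * Rabs (Re z) <= 1).
Proof.
  intros Ht.
  destruct (nat_ceil (10 * t)) as [N [HN1 HN2]]; [lra|].
  set (eta := / (2 * t)).
  assert (He : 0 < eta) by (apply Rinv_0_lt_compat; lra).
  assert (Het : eta * t = / 2) by (unfold eta; field; lra).
  set (b := / INR N). assert (Hb : 0 < b) by (apply Rinv_0_lt_compat; lra).
  assert (HbN : b * INR N = 1) by (unfold b; field; lra).
  exists (expsum (dirichlet_terms b eta N)), (expsum (expsum_deriv (dirichlet_terms b eta N))).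
  split; [|split; [|split; [|split]]].
  - exists (dirichlet_terms b eta N); split; [|split; reflexivity].
    apply dirichlet_terms_frequencies; lra.
  - replace (RtoC 1) with (RtoC (b * INR N)) by (f_equal; exact HbN).
    clearbody b; clear; induction N as [|N IH]; simpl.
    + rewrite Rmult_0_r; reflexivity.
    + rewrite IH. replace (imag (eta * INR N) * 0)%C with (RtoC 0) by ring.
      rewrite Cexp_0. change (match N with O => 1 | S _ => INR N + 1 end) with (INR (S N)).
      rewrite S_INR, !RtoC_mult, RtoC_plus; ring.
  - intros z Hz. destruct (Cmod_expsum_dirichlet b eta N z) as [H _]; lra.
  - intros z Hz. destruct (Cmod_expsum_dirichlet b eta N z) as [_ H]; try lra.
    eapply Rle_trans; [exact H|]. rewrite HbN.
    assert (eta * INR N <= eta * (12 * t)) by (apply Rmult_le_compat_l; lra). nra.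
  - intros z Hz Hr.
    assert (E := dirichlet_closed_form b eta N z).
    set (w := (imag eta * z)%C) in *.
    assert (Iw : Im w = eta * Re z) by (unfold w; destruct z; simpl; ring).
    assert (Rw : Re w <= 0) by (unfold w; destruct z; simpl in *; nra).
    assert (Habs : Rabs (Im w) <= 1).
    { rewrite Iw; apply Rabs_le; split; nra. }
    assert (G := Cmod_one_minus_Cexp_ge w Rw Habs).
    rewrite Iw, Rabs_mult, (Rabs_pos_eq eta) in G by lra.
    assert (E1 : Cmod (1 - Cexp w) * Cmod (expsum (dirichlet_terms b eta N) z) <= b * 2).
    { rewrite <- Cmod_mult, E, Cmod_mult, Cmod_R, Rabs_pos_eq by lra.
      apply Rmult_le_compat_l; [lra|].
      eapply Rle_trans; [apply Cmod_triangle_minus|]. rewrite Cmod_1.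
      assert (Q := Cmod_Cexp_upper (eta * INR N) z). 
      assert (0 <= eta * INR N) by (apply Rmult_le_pos; lra). lra. }
    set (d := Cmod (expsum (dirichlet_terms b eta N) z)) in *.
    assert (d0 : 0 <= d) by apply Cmod_ge_0.
    assert (E2 : 4 / 10 * (eta * Rabs (Re z)) * d <= b * 2).
    { eapply Rle_trans; [|exact E1]. apply Rmult_le_compat_r; lra. }
    assert (X0 : 0 <= d * Rabs (Re z)) by (apply Rmult_le_pos; [lra|apply Rabs_pos]).
    set (X := d * Rabs (Re z)) in *.
    replace (4 / 10 * (eta * Rabs (Re z)) * d) with (4 / 10 * eta * X) in E2 by (unfold X; ring).
    apply Rmult_le_compat_r with (r := INR N) in E2; [|lra].
    replace (b * 2 * INR N) with 2 in E2 by (transitivity (2 * (b * INR N)); [rewrite HbN|]; ring).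
    assert (E3 : 4 / 10 * eta * X * (10 * t) <= 2).
    { eapply Rle_trans; [|exact E2]. apply Rmult_le_compat_l; [|lra].
      apply Rmult_le_pos; lra. }
    replace (4 / 10 * eta * X * (10 * t)) with (4 * (eta * t) * X) in E3 by field. 
    rewrite Het in E3. lra.
Qed.

Lemma pow_le_sq (d : R) (n : nat) : 0 <= d <= 1 -> (2 <= n)%nat -> d ^ n <= d ^ 2.
Proof.
  intros Hd Hn; replace n with (2 + (n - 2))%nat by lia. rewrite pow_add.
  rewrite <- (Rmult_1_r (d ^ 2)) at 2.
  apply Rmult_le_compat_l; [apply pow_le; lra|].
  rewrite <- (pow1 (n - 2)); apply pow_incr; lra.
Qed.

Lemma exp_pow (x : R) (n : nat) : exp x ^ n = exp (INR n * x).
Proof.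
  induction n as [|n IH]; [simpl; rewrite Rmult_0_l, exp_0; reflexivity|].
  rewrite S_INR, Rmult_plus_distr_r, Rmult_1_l, Rplus_comm, exp_plus, <- IH; reflexivity.
Qed.

(** The bump [1 / (1 + (s - t)^2)] describes a packet centred at [t]; the second
    summand absorbs the later periods of the kernel.  Both have integrals bounded
    independently of [m] and [t]. *)
Definition envelope (m t s : R) : R := / (1 + (s - t) ^ 2) + / m * exp (- (s / m)).

(** Here [d] stands for the modulus of the kernel at distance [u = s - t] from the
    peak.  For [u > 2 t] the damping alone suffices, because its accumulated
    effect exceeds [m].  For [-3 <= u <= 2 t] two factors [d] give the bump.  For
    [-t <= u <= -3] the factor [e^(-delta u)] grows, but never above
    [e^(delta t)], which [n - 2] factors [d <= 1/3 <= e^(-1)] compensate. *)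
Lemma envelope_bound (c m m0 t x s d : R) (n : nat) :
  1 <= c -> 0 < m0 -> m0 <= m -> 3 <= t -> 0 <= x <= / m ->
  m <= exp (c * t / m) -> (3 + c) / m * t <= INR n - 2 -> 0 <= s -> 0 <= d <= 1 ->
  (s - t <= 2 * t -> d * Rabs (s - t) <= 1) ->
  exp (x * s) * (exp (- ((3 + c) / m) * (s - t)) * d ^ n) <=
  2 * exp (3 * (3 + c) / m0) * exp (x * t) * envelope m t s.
Proof.
  intros Hc Hm0 Hm Ht Hx Hmt Hn Hs Hd Hdu.
  set (u := s - t) in *. set (delta := (3 + c) / m) in *.
  assert (Hmp : 0 < m) by lra.
  assert (Him : 0 < / m) by (apply Rinv_0_lt_compat; lra).
  assert (Hdm : delta = (3 + c) * / m) by reflexivity.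
  assert (Hdelta : 0 < delta) by (rewrite Hdm; nra).
  assert (Hdelta' : delta <= (3 + c) / m0).
  { unfold delta, Rdiv; apply Rmult_le_compat_l; [lra|]. apply Rinv_le_contravar; lra. }
  assert (n_ge : (2 <= n)%nat).
  { apply INR_le; simpl. assert (0 <= delta * t) by nra. lra. }
  replace (exp (x * s)) with (exp (x * t) * exp (x * u)) by (rewrite <- exp_plus; f_equal; unfold u; ring).
  set (Q := exp (3 * (3 + c) / m0)).
  assert (HQ : 1 <= Q).
  { unfold Q; rewrite <- exp_0; apply exp_le_compat. apply Rdiv_le_0_compat; lra. }
  rewrite Rmult_assoc.
  replace (2 * Q * exp (x * t) * envelope m t s) with (exp (x * t) * (2 * Q * envelope m t s)) by ring.
  apply Rmult_le_compat_l; [left; apply exp_pos|].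
  rewrite <- Rmult_assoc, <- exp_plus.
  replace (x * u + - delta * u) with (- (delta - x) * u) by ring.
  assert (Hdx : 0 <= delta - x) by (rewrite Hdm; nra).
  assert (Hsq : 0 < 1 + u ^ 2) by nra.
  assert (T1 : 0 < / (1 + u ^ 2)) by (apply Rinv_0_lt_compat, Hsq).
  assert (T2 : 0 < / m * exp (- (s / m))) by (apply Rmult_lt_0_compat; [lra|apply exp_pos]).
  assert (Henv : envelope m t s = / (1 + u ^ 2) + / m * exp (- (s / m))) by reflexivity.
  destruct (Rle_dec u (2 * t)) as [Hu|Hu].
  - specialize (Hdu Hu).
    assert (Hd2 : d ^ 2 * (1 + u ^ 2) <= 2).
    { replace (d ^ 2 * (1 + u ^ 2)) with (d * d + (d * Rabs u) * (d * Rabs u)).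
      - assert (0 <= d * Rabs u) by (apply Rmult_le_pos; [lra|apply Rabs_pos]). nra.
      - replace (u ^ 2) with (Rabs u * Rabs u); [ring|].
        rewrite <- Rabs_mult, Rabs_pos_eq; [ring|apply Rle_0_sqr]. }
    assert (Hd2' : d ^ 2 <= 2 * / (1 + u ^ 2)).
    { apply Rmult_le_reg_r with (1 + u ^ 2); [exact Hsq|].
      rewrite Rmult_assoc, Rinv_l by lra. lra. }
    assert (Key : exp (- (delta - x) * u) * d ^ n <= Q * d ^ 2).
    { destruct (Rle_dec (- 3) u) as [Hu3|Hu3].
      - apply Rmult_le_compat; [left; apply exp_pos|apply pow_le; lra| |apply pow_le_sq; assumption].
        apply exp_le_compat. 
        apply Rle_trans with (3 * delta); [nra|].
        replace (3 * (3 + c) / m0) with (3 * ((3 + c) / m0)) by (field; lra). lra.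
      - (* the bound 3 is used as an upper bound for the number e *)
        set (y := - u). assert (Hy : 3 <= y) by (unfold y; lra).
        assert (Hyt : y <= t) by (unfold y, u; lra).
        assert (Hdy : d * y <= 1).
        { rewrite Rabs_left in Hdu by lra. exact Hdu. }
        replace n with (2 + (n - 2))%nat by lia. rewrite pow_add.
        apply Rle_trans with (1 * d ^ 2); [|apply Rmult_le_compat_r; [apply pow_le; lra|exact HQ]].
        replace (exp (- (delta - x) * u) * (d ^ 2 * d ^ (n - 2))) with
          ((exp (- (delta - x) * u) * d ^ (n - 2)) * d ^ 2) by ring.
        apply Rmult_le_compat_r; [apply pow_le; lra|].
        assert (Hd1 : d <= exp (- (1))).
        { rewrite exp_Ropp. apply Rmult_le_reg_r with y; [lra|]. eapply Rle_trans; [exact Hdy|].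
          assert (E3 := exp_le_3). assert (E0 := exp_pos 1).
          apply Rmult_le_reg_l with (exp 1); [exact E0|].
          rewrite <- Rmult_assoc, Rinv_r by lra. lra. }
        apply Rle_trans with (exp (- (delta - x) * u) * exp (- (1)) ^ (n - 2)).
        { apply Rmult_le_compat_l; [left; apply exp_pos|]. apply pow_incr; lra. }
        rewrite exp_pow, <- exp_plus.
        apply Rle_trans with (exp 0); [apply exp_le_compat|rewrite exp_0; apply Rle_refl].
        rewrite minus_INR by lia. change (INR 2) with 2.
        assert (delta * y <= delta * t) by (apply Rmult_le_compat_l; lra).
        assert (0 <= x * y) by (apply Rmult_le_pos; lra).
        replace (- (delta - x) * u) with (delta * y - x * y) by (unfold y; ring). lra. }
    eapply Rle_trans; [exact Key|]. rewrite Henv.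
    apply Rle_trans with (Q * (2 * / (1 + u ^ 2))); [apply Rmult_le_compat_l; [lra|exact Hd2']|].
    assert (0 <= Q * (/ m * exp (- (s / m)))) by (apply Rmult_le_pos; lra).
    set (X := / (1 + u ^ 2)) in *. lra.
  - apply Rnot_le_lt in Hu.
    apply Rle_trans with (1 * (/ m * exp (- (s / m)))).
    2:{ rewrite Henv; apply Rmult_le_compat; lra. }
    apply Rle_trans with (exp (- (delta - x) * u) * 1).
    { apply Rmult_le_compat_l; [left; apply exp_pos|]. rewrite <- (pow1 n); apply pow_incr; lra. }
    rewrite Rmult_1_r, Rmult_1_l.
    apply Rle_trans with (exp (- (c * t / m)) * exp (- (s / m))).
    + rewrite <- exp_plus. apply exp_le_compat.
      replace (- (c * t / m) + - (s / m)) with (- ((c * t + s) * / m)) by (field; lra).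
      apply Rle_trans with (- ((2 + c) * / m) * u).
      * assert ((2 + c) * / m <= delta - x) by (rewrite Hdm; lra). nra.
      * assert (c * t + s <= (2 + c) * u) by (unfold u in *; nra). nra.
    + apply Rmult_le_compat_r; [left; apply exp_pos|].
      rewrite exp_Ropp. apply Rinv_le_contravar; lra.
Qed.

Lemma envelope_le (m m0 t s : R) : 0 < m0 -> m0 <= m -> 0 <= s -> envelope m t s <= 1 + / m0.
Proof.
  intros H0 Hm Hs; unfold envelope; apply Rplus_le_compat.
  - rewrite <- Rinv_1; apply Rinv_le_contravar; [lra|]. assert (0 <= (s - t) ^ 2) by apply pow2_ge_0. lra.
  - rewrite <- (Rmult_1_r (/ m0)). apply Rmult_le_compat.
    + left; apply Rinv_0_lt_compat; lra.
    + left; apply exp_pos.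
    + apply Rinv_le_contravar; lra.
    + rewrite <- exp_0; apply exp_le_compat.
      assert (0 <= s / m) by (apply Rdiv_le_0_compat; lra). lra.
Qed.

Definition envelope_prim (m t s : R) : R := atan (s - t) - exp (- (s / m)).

Lemma envelope_prim_derive (m t s : R) : 0 < m -> is_derive (envelope_prim m t) s (envelope m t s).
Proof.
  intros Hm; unfold envelope_prim, envelope; auto_derive; [trivial|].
  assert (0 <= (s - t) ^ 2) by apply pow2_ge_0.
  change (s / m) with (s * / m); field; split; [|lra]. simpl in *; lra.
Qed.

Lemma envelope_continuous (m t s : R) : 0 < m -> continuous (envelope m t) s.
Proof.
  intros Hm. apply (ex_derive_continuous (K := R_AbsRing) (V := R_NormedModule)).
  unfold envelope; auto_derive. 
  assert (0 <= (s - t) ^ 2) by apply pow2_ge_0. simpl in *; lra.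
Qed.

Lemma envelope_prim_bound (m t T : R) : envelope_prim m t T - envelope_prim m t 0 <= 5.
Proof.
  unfold envelope_prim.
  assert (A := atan_bound (T - t)). assert (B := atan_bound (0 - t)). assert (P := PI_4).
  assert (E := exp_pos (- (T / m))). 
  replace (- (0 / m)) with 0 by (unfold Rdiv; ring). rewrite exp_0. lra.
Qed.

Lemma expsum_laplace_envelope (l : list (C * C)) (z : C) (m t B : R) : 0 < m -> 0 <= B ->
  freqs_in (fun mu => Re mu < Re z) l ->
  (forall s, 0 <= s -> exp (- (Re z * s)) * Cmod (expsum l (RtoC s)) <= B * envelope m t s) ->
  Cmod (expsum_laplace l z) <= 5 * B.
Proof.
  intros Hm HB Hl H.
  apply (expsum_laplace_bound l z (fun s => B * envelope m t s) (fun s => B * envelope_prim m t s)); auto.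
  - intros s; apply is_derive_scal, envelope_prim_derive, Hm.
  - intros s; apply (continuous_mult (K := R_AbsRing) (fun _ => B));
      [apply continuous_const|apply envelope_continuous, Hm].
  - intros T _. assert (Q := envelope_prim_bound m t T).
    apply Rmult_le_compat_l with (r := B) in Q; lra.
Qed.

(** The test function is
    [f(z) = e^(nu (z - t)) D(z - t)^n / R] with [nu = -(3 + c)/m + i (R + 1)] and
    [D] the kernel above.  The real part of [nu] puts the frequencies outside the
    region of holomorphy.  On the imaginary half-axis the factor
    [e^((3 + c) t / m)] is beaten by [|D(-t + i s)|^n <= e^(-n)], and the oscillation
    at frequency [R + 1] becomes decay. *)
Lemma wave_packet (c t R m m0 : R) (n : nat) :
  1 <= c -> 3 <= t -> 1 <= R -> 0 < m0 -> m0 <= m -> m <= exp (c * t / m) ->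
  (3 + c) / m * t <= INR n - 3 -> 
  exists l : list (C * C),
    freqs_in (fun mu => Re mu = - ((3 + c) / m) /\ R + 1 <= Im mu) l /\
    Cmod (expsum l (RtoC t)) = / R /\
    (forall x s, 0 <= x <= / m -> 0 <= s ->
      exp (x * s) * Cmod (expsum l (RtoC s)) <=
        / R * (2 * exp (3 * (3 + c) / m0)) * exp (x * t) * envelope m t s /\
      exp (x * s) * Cmod (expsum (expsum_deriv l) (RtoC s)) <=
        / R * ((3 + c) / m0 + 2 * R + 6 * INR n) * (2 * exp (3 * (3 + c) / m0))
          * exp (x * t) * envelope m t s) /\
    (forall s, 0 <= s -> Cmod (expsum l (Ci * RtoC s)) <= / R * exp (- ((R + 1) * s))).
Proof.
  intros Hc Ht HR Hm0 Hm Hmt Hn.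
  assert (Hmp : 0 < m) by lra.
  set (delta := (3 + c) / m) in *.
  assert (Hdelta : 0 < delta) by (apply Rdiv_lt_0_compat; lra).
  assert (Hdt : 0 < delta * t) by (apply Rmult_lt_0_compat; lra).
  assert (Hdelta' : delta <= (3 + c) / m0).
  { unfold delta, Rdiv; apply Rmult_le_compat_l; [lra|]. apply Rinv_le_contravar; lra. }
  assert (n_ge : (3 <= n)%nat) by (apply INR_le; simpl; lra).
  (* the kernel is shifted to t only after the product has been formed *)
  destruct (dirichlet_kernel t) as (D & D' & HD & D0 & Dle & D'le & Ddecay); [lra|].
  set (nu := (- delta, R + 1) : C).
  assert (HiR : 0 < / R) by (apply Rinv_0_lt_compat; lra).
  assert (Hprod : is_expsum (fun mu => Re mu = - delta /\ R + 1 <= Im mu)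
    (fun z => RtoC (/ R) * Cexp (nu * z) * D z ^ n)%C
    (fun z => RtoC (/ R) * nu * Cexp (nu * z) * D z ^ n +
       RtoC (/ R) * Cexp (nu * z) * (RtoC (INR n) * D z ^ pred n * D' z))%C).
  { apply (is_expsum_mul (fun mu => mu = nu) upper_frequency).
    - intros a b -> [H1 H2]; unfold nu; destruct b; simpl in *; lra.
    - apply is_expsum_exp; reflexivity.
    - apply is_expsum_pow; [split; simpl; lra| |exact HD].
      intros [a1 a2] [b1 b2] [H1 H2] [H3 H4]; split; simpl in *; lra. }
  destruct (is_expsum_shift _ _ _ (RtoC t) Hprod) as (l & Hl & Hf & Hf').
  exists l; split; [exact Hl|split; [|split]].
  - rewrite <- Hf. replace (t - t)%C with (RtoC 0) by ring.
    rewrite D0, Cmult_0_r, Cexp_0, Cpow_1_l, !Cmult_1_r, Cmod_R, Rabs_pos_eq; lra.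
  - intros x s Hx Hs. rewrite <- Hf, <- Hf', <- RtoC_minus.
    set (u := s - t).
    set (d := Cmod (D (RtoC u))).
    assert (Hd : 0 <= d <= 1) by (split; [apply Cmod_ge_0|apply Dle; simpl; lra]).
    assert (Hdu : u <= 2 * t -> d * Rabs u <= 1).
    { intros Hu; apply (Ddecay (RtoC u)); simpl; unfold u in *; lra. }
    assert (Env : exp (x * s) * (exp (- delta * u) * d ^ pred n) <=
      2 * exp (3 * (3 + c) / m0) * exp (x * t) * envelope m t s).
    { apply (envelope_bound c m m0 t x s d (pred n)); auto.
      replace n with (S (pred n)) in Hn by lia. rewrite S_INR in Hn. fold delta; lra. }
    set (X := exp (x * s)) in *. assert (HX : 0 < X) by apply exp_pos.
    set (Y := exp (- delta * u)) in *. assert (HY : 0 < Y) by apply exp_pos.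
    assert (ECexp : Cmod (Cexp (nu * RtoC u)) = Y).
    { rewrite Cmod_Cexp; unfold Y; f_equal; unfold nu; simpl; ring. }
    set (p := d ^ pred n) in *. assert (Hp : 0 <= p) by (apply pow_le; lra).
    assert (Epn : d ^ n = d * p) by (unfold p; replace n with (S (pred n)) at 1 by lia; reflexivity).
    set (E := 2 * exp (3 * (3 + c) / m0) * exp (x * t) * envelope m t s) in *.
    assert (HXYp : 0 <= X * (Y * p)) by (apply Rmult_le_pos; [lra|apply Rmult_le_pos; lra]).
    split.
    + rewrite !Cmod_mult, Cmod_pow, ECexp, Cmod_R, Rabs_pos_eq by lra. fold d.
      rewrite Epn.
      replace (X * (/ R * Y * (d * p))) with (/ R * (d * (X * (Y * p)))) by ring.
      replace (/ R * (2 * exp (3 * (3 + c) / m0)) * exp (x * t) * envelope m t s) with (/ R * E)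
        by (unfold E; ring).
      apply Rmult_le_compat_l; [lra|]. nra.
    + assert (Hnu : Cmod nu <= delta + (R + 1)).
      { eapply Rle_trans; [apply Cmod_le_abs|]. unfold nu; simpl.
        rewrite Rabs_Ropp, !Rabs_pos_eq; lra. }
      assert (HD' : Cmod (D' (RtoC u)) <= 6) by (apply D'le; simpl; lra).
      set (A := (3 + c) / m0 + 2 * R + 6 * INR n).
      assert (HA : delta + (R + 1) + INR n * 6 <= A) by (unfold A; lra).
      assert (HnI := pos_INR n).
      apply Rle_trans with (X * (/ R * Y * p * A)).
      * apply Rmult_le_compat_l; [lra|].
        eapply Rle_trans; [apply Cmod_triangle|].
        rewrite !Cmod_mult, !Cmod_pow, ECexp, !Cmod_R, !Rabs_pos_eq by lra. fold d p.
        rewrite Epn.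
        assert (B0 : 0 <= / R * Y * p) by (apply Rmult_le_pos; [apply Rmult_le_pos; lra|lra]).
        assert (B1 : / R * Cmod nu * Y * (d * p) <= / R * Y * p * (delta + (R + 1))).
        { replace (/ R * Cmod nu * Y * (d * p)) with (/ R * Y * p * (Cmod nu * d)) by ring.
          apply Rmult_le_compat_l; [exact B0|]. assert (N0 := Cmod_ge_0 nu). nra. }
        assert (B2 : / R * Y * (INR n * p * Cmod (D' (RtoC u))) <= / R * Y * p * (INR n * 6)).
        { replace (/ R * Y * (INR n * p * Cmod (D' (RtoC u)))) with
            (/ R * Y * p * (INR n * Cmod (D' (RtoC u)))) by ring.
          apply Rmult_le_compat_l; [exact B0|]. apply Rmult_le_compat_l; lra. }
        apply Rle_trans with (/ R * Y * p * (delta + (R + 1) + INR n * 6)); [lra|].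
        apply Rmult_le_compat_l; [exact B0|exact HA].
      * assert (A0 : 0 <= A) by lra.
        replace (X * (/ R * Y * p * A)) with (/ R * A * (X * (Y * p))) by ring.
        replace (/ R * A * (2 * exp (3 * (3 + c) / m0)) * exp (x * t) * envelope m t s)
          with (/ R * A * E) by (unfold E; ring).
        apply Rmult_le_compat_l; [apply Rmult_le_pos; lra|exact Env].
  - intros s Hs. rewrite <- Hf.
    set (z := (Ci * s - t)%C).
    assert (Rz : Re z = - t) by (unfold z; simpl; ring).
    assert (Iz : Im z = s) by (unfold z; simpl; ring).
    rewrite !Cmod_mult, Cmod_pow, Cmod_Cexp, Cmod_R, Rabs_pos_eq by lra.
    rewrite Rmult_assoc; apply Rmult_le_compat_l; [lra|].
    assert (Ed : Cmod (D z) <= exp (- (1))).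
    { assert (H := Ddecay z). rewrite Rz, Iz, Rabs_Ropp, Rabs_pos_eq in H by lra.
      specialize (H Hs ltac:(lra)).
      rewrite exp_Ropp. apply Rmult_le_reg_r with t; [lra|]. eapply Rle_trans; [exact H|].
      assert (E3 := exp_le_3). assert (E0 := exp_pos 1).
      apply Rmult_le_reg_l with (exp 1); [exact E0|].
      rewrite <- Rmult_assoc, Rinv_r by lra. lra. }
    apply Rle_trans with (exp (Re (nu * z)%C) * exp (- (1)) ^ n).
    + apply Rmult_le_compat_l; [left; apply exp_pos|]. apply pow_incr; split; [apply Cmod_ge_0|exact Ed].
    + rewrite exp_pow, <- exp_plus; apply exp_le_compat.
      replace (Re (nu * z)%C) with (delta * t - (R + 1) * s).
      * lra.
      * change (delta * t - (R + 1) * s = - delta * Re z - (R + 1) * Im z). rewrite Rz, Iz; ring.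
Qed.

(** * From wave packets to the decay rate *)

(** Rotated integral, for points below all the frequencies. *)
Lemma expsum_laplace_upper_bound (l : list (C * C)) (z : C) (R b : R) :
  0 <= b -> Im z <= R -> freqs_in (fun mu => R + 1 <= Im mu) l ->
  (forall s, 0 <= s -> Cmod (expsum l (Ci * RtoC s)) <= b * exp (- ((R + 1) * s))) ->
  Cmod (expsum_laplace l z) <= b.
Proof.
  intros Hb Hz Hl H.
  rewrite <- expsum_laplace_rotate.
  2:{ intros p Hp E; specialize (Hl p Hp); simpl in Hl; rewrite E in Hl; lra. }
  apply (expsum_laplace_bound _ _ (fun s => b * exp (- s)) (fun s => - b * exp (- s))).
  - intros p Hp; apply in_map_iff in Hp as (q & <- & Hq); specialize (Hl q Hq).
    destruct q as [q0 [q1 q2]], z; simpl in *; lra.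
  - intros s Hs; rewrite expsum_rotate_eq, Cmod_mult, Cmod_Ci, Rmult_1_l.
    replace (- (Re (Ci * z) * s)) with (Im z * s) by (destruct z; simpl; ring).
    apply Rle_trans with (exp (Im z * s) * (b * exp (- ((R + 1) * s)))).
    + apply Rmult_le_compat_l; [left; apply exp_pos|apply H, Hs].
    + replace (exp (Im z * s) * (b * exp (- ((R + 1) * s)))) with
        (b * (exp (Im z * s) * exp (- ((R + 1) * s)))) by ring.
      rewrite <- exp_plus. apply Rmult_le_compat_l; [exact Hb|]. apply exp_le_compat. nra.
  - intros s; auto_derive; [trivial|ring].
  - intros s; apply (ex_derive_continuous (K := R_AbsRing) (V := R_NormedModule)).
    auto_derive; trivial.
  - intros T HT; rewrite Ropp_0, exp_0.
    assert (0 <= b * exp (- T)) by (apply Rmult_le_pos; [exact Hb|left; apply exp_pos]). lra.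
Qed.

(** As in the preceding bound; the gap of one between [R] and the frequencies pays
    for the factor [s] in [|e^(-i z s) - e^(-i z' s)| <= |z - z'| s e^(R s)]. *)
Lemma expsum_laplace_upper_lipschitz (l : list (C * C)) (z z' : C) (R b : R) :
  0 <= b -> Im z <= R -> Im z' <= R -> freqs_in (fun mu => R + 1 <= Im mu) l ->
  (forall s, 0 <= s -> Cmod (expsum l (Ci * RtoC s)) <= b * exp (- ((R + 1) * s))) ->
  Cmod (expsum_laplace l z - expsum_laplace l z')%C <= b * Cmod (z - z')%C.
Proof.
  intros Hb Hz Hz' Hl H.
  assert (Hrot : forall z, Im z <= R -> expsum_laplace (expsum_rotate l) (Ci * z) = expsum_laplace l z).
  { intros y Hy; apply expsum_laplace_rotate; intros p Hp E.
    specialize (Hl p Hp); simpl in Hl; rewrite E in Hl; lra. }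
  rewrite <- (Hrot z Hz), <- (Hrot z' Hz').
  assert (Hfr : forall z, Im z <= R -> freqs_in (fun mu => Re mu < Re (Ci * z)) (expsum_rotate l)).
  { intros y Hy p Hp; apply in_map_iff in Hp as (q & <- & Hq); specialize (Hl q Hq).
    destruct q as [q0 [q1 q2]], y; simpl in *; lra. }
  set (k := b * Cmod (z - z')%C).
  assert (D0 := Cmod_ge_0 (z - z')%C).
  assert (Hk : 0 <= k) by (apply Rmult_le_pos; assumption).
  apply (expsum_laplace_sub_bound _ _ _ (fun s => k * (s * exp (- s)))
    (fun s => - k * ((s + 1) * exp (- s)))); auto.
  - intros s Hs; rewrite expsum_rotate_eq, Cmod_mult, Cmod_Ci, Rmult_1_l.
    assert (E1 : Cmod (Cexp (- (Ci * z * s)) - Cexp (- (Ci * z' * s)))%C <=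
      Cmod (z - z')%C * s * exp (R * s)).
    { eapply Rle_trans; [apply (Cexp_sub _ _ (R * s))|].
      - replace (Re (- (Ci * z * s))%C) with (Im z * s) by (destruct z; simpl; ring). nra.
      - replace (Re (- (Ci * z' * s))%C) with (Im z' * s) by (destruct z'; simpl; ring). nra.
      - apply Rmult_le_compat_r; [left; apply exp_pos|].
        replace (- (Ci * z * s) - - (Ci * z' * s))%C with (- Ci * (z - z') * RtoC s)%C by ring.
        rewrite !Cmod_mult, Cmod_opp, Cmod_Ci, Cmod_R, Rabs_pos_eq; lra. }
    apply Rle_trans with ((Cmod (z - z')%C * s * exp (R * s)) * (b * exp (- ((R + 1) * s)))).
    + apply Rmult_le_compat; try apply Cmod_ge_0; auto.
    + right. replace (- ((R + 1) * s)) with (- (R * s) + - s) by ring.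
      rewrite exp_plus, (exp_Ropp (R * s)). unfold k. field. apply Rgt_not_eq, exp_pos.
  - intros s; auto_derive; [trivial|ring].
  - intros s; apply (ex_derive_continuous (K := R_AbsRing) (V := R_NormedModule)).
    auto_derive; trivial.
  - intros T HT; rewrite Ropp_0, exp_0.
    assert (0 <= k * ((T + 1) * exp (- T)))
      by (apply Rmult_le_pos; [exact Hk|apply Rmult_le_pos; [lra|left; apply exp_pos]]). lra.
Qed.

Lemma ln_le_sub_1 (x : R) : 0 < x -> ln x <= x - 1.
Proof.
  intros Hx. rewrite <- (ln_exp (x - 1)).
  assert (E := exp_ineq1_le (x - 1)). 
  destruct (Rle_lt_or_eq_dec x (exp (x - 1))) as [H|H]; [lra|left; apply ln_increasing; lra|].
  rewrite <- H; apply Rle_refl.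
Qed.

Lemma Mlog_quotient (M : R -> R) (c t R : R) : 0 < M R -> 0 <= R -> c * t = Mlog M R ->
  exp (c * t / M R) = (1 + R) * (1 + M R).
Proof.
  intros HM HR E; rewrite E; unfold Mlog.
  replace (M R * (ln (1 + R) + ln (1 + M R)) / M R) with (ln (1 + R) + ln (1 + M R)) by (field; lra).
  rewrite exp_plus, !exp_ln by lra; reflexivity.
Qed.

(** Two representations of the transform [F] of a wave packet are combined.  Where
    [|Im z| >= R], monotonicity of [M] gives [Re z > -1/M(R)], the Laplace
    integral still converges there, and its size is governed by [e^(t / M(R))].
    Where [|Im z| < R], the rotated integral bounds [F] by [1/R] however far to the
    left [z] lies.  For [z F(z)] one integrates by parts, except where
    [|Im z| < R] and [Re z < 0], since there [|z| = O(R)].  The number of factors [n] must be of order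
    [R], both to compensate [e^((3 + c) t / M(R))] and to keep [f'] bounded; this
    is where the exponential bound on [M] enters, through
    [ln (1 + M(s)) <= B (1 + s)]. *)
Lemma wave_packet_transform (M : R -> R) (c B : R) :
  (forall s, 0 <= s -> 0 < M s) -> nondecreasing_on_Rplus M -> 1 <= c -> 0 <= B ->
  (forall s, 0 <= s -> ln (1 + M s) <= B * (1 + s)) ->
  exists K, 0 < K /\ forall t R, 3 <= t -> 1 <= R -> c * t = Mlog M R ->
  exists l : list (C * C),
    freqs_in (fun mu => Re mu < 0 /\ ~ Omega M mu) l /\
    Cmod (expsum l (RtoC t)) = / R /\
    (forall s, 0 <= s -> Cmod (expsum l (RtoC s)) <= K /\
       Cmod (expsum (expsum_deriv l) (RtoC s)) <= K) /\
    (forall z, Omega M z -> R <= Rabs (Im z) ->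
       Cmod (expsum_laplace l z) <= K * (exp (t / M R) / R) /\
       Cmod (z * expsum_laplace l z)%C <= K * exp (t / M R)) /\
    (forall z, Omega M z -> Rabs (Im z) < R ->
       Cmod (expsum_laplace l z) <= K /\ Cmod (z * expsum_laplace l z)%C <= K) /\
    (forall z z', Rabs (Im z) <= R -> Rabs (Im z') <= R ->
       Cmod (expsum_laplace l z - expsum_laplace l z')%C <= K * Cmod (z - z')%C).
Proof.
  intros M_pos M_incr Hc HB HM.
  set (m0 := M 0). assert (Hm0 : 0 < m0) by (apply M_pos; lra).
  set (A := 3 + c). set (C0 := 2 * exp (3 * A / m0)).
  set (N0 := A * (1 + 2 * B) + 4). set (C2 := A / m0 + 2 + 6 * N0).
  assert (HA : 4 <= A) by (unfold A; lra).
  assert (HN0 : 0 <= N0) by (unfold N0; nra).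
  assert (HAm : 0 < A / m0) by (apply Rdiv_lt_0_compat; lra).
  assert (HC0 : 2 <= C0).
  { unfold C0. assert (1 <= exp (3 * A / m0)); [|lra].
    rewrite <- exp_0; apply exp_le_compat, Rdiv_le_0_compat; lra. }
  assert (HC2 : 2 <= C2) by (unfold C2; lra).
  set (i := / m0). assert (Hi : 0 < i) by (apply Rinv_0_lt_compat; lra).
  set (P := C0 * C2). assert (HP1 : 2 * C0 <= P) by (unfold P; nra). 
  assert (HP2 : 2 * C2 <= P) by (unfold P; nra).
  assert (HPi1 : C0 * i <= P * i) by (apply Rmult_le_compat_r; lra).
  assert (HPi2 : 1 * i <= P * i) by (apply Rmult_le_compat_r; lra).
  (* ten covers 5 C0, 5 C0 C2 and the values at 0, each up to the factor 1 + i *)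
  set (K := 10 * (P + P * i)).
  assert (HC0i : 0 < C0 * i) by (apply Rmult_lt_0_compat; lra).
  assert (HPi : 0 < P * i) by (apply Rmult_lt_0_compat; lra).
  assert (HK : 0 < K) by (unfold K; lra).
  exists K; split; [exact HK|].
  intros t R Ht HR Hct.
  set (m := M R). assert (Hm : m0 <= m) by (apply M_incr; lra).
  assert (Hmp : 0 < m) by lra.
  assert (Heq : exp (c * t / m) = (1 + R) * (1 + m)) by (apply Mlog_quotient; [exact Hmp|lra|exact Hct]).
  destruct (nat_ceil (A * (1 + 2 * B) * R + 3)) as [n [Hn1 Hn2]].
  { apply Rplus_le_le_0_compat; [|lra]. apply Rmult_le_pos; [|lra]. apply Rmult_le_pos; lra. }
  destruct (wave_packet c t R m m0 n) as (l & Hl & Hlt & Hreal & Himag); auto.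
  { rewrite Heq; nra. }
  { fold A. apply Rle_trans with (A * (1 + 2 * B) * R); [|lra].
    assert (El : t <= m * ((1 + 2 * B) * R)).
    { apply Rle_trans with (c * t); [nra|]. rewrite Hct; unfold Mlog; fold m.
      apply Rmult_le_compat_l; [lra|].
      assert (G1 := ln_le_sub_1 (1 + R) ltac:(lra)).
      assert (G2 := HM R ltac:(lra)). fold m in G2. nra. }
    apply Rmult_le_compat_l with (r := A / m) in El; [|left; apply Rdiv_lt_0_compat; lra].
    replace (A / m * (m * ((1 + 2 * B) * R))) with (A * (1 + 2 * B) * R) in El by (field; lra).
    exact El. }
  fold A in Hl, Hreal; fold C0 in Hreal.
  assert (HiR : 0 < / R <= 1).
  { split; [apply Rinv_0_lt_compat; lra|]. rewrite <- Rinv_1; apply Rinv_le_contravar; lra. }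
  assert (Him : 0 < / m) by (apply Rinv_0_lt_compat; lra).
  assert (HAdm : / m < A / m) by (unfold Rdiv; nra).
  assert (HC2R : / R * (A / m0 + 2 * R + 6 * INR n) <= C2).
  { apply Rmult_le_reg_l with R; [lra|]. rewrite <- Rmult_assoc, Rinv_r, Rmult_1_l by lra.
    unfold C2, N0. assert (A / m0 * 1 <= A / m0 * R) by (apply Rmult_le_compat_l; lra). nra. }
  assert (Hfreq1 : forall z, - / m <= Re z -> freqs_in (fun mu => Re mu < Re z) l).
  { intros z Hz p Hp; destruct (Hl p Hp) as [H1 _]. rewrite H1; lra. }
  assert (HlO : freqs_in (fun mu => Re mu < 0 /\ ~ Omega M mu) l).
  { intros p Hp; destruct (Hl p Hp) as [H1 H2]. rewrite H1; split; [lra|].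
    unfold Omega; rewrite H1; intros H3.
    assert (H4 : m <= M (Rabs (Im (snd p)))).
    { apply M_incr; [lra|]. rewrite Rabs_pos_eq; lra. }
    assert (1 / M (Rabs (Im (snd p))) <= / m).
    { unfold Rdiv; rewrite Rmult_1_l; apply Rinv_le_contravar; lra. }
    lra. }
  assert (env_pos : forall s, 0 < envelope m t s).
  { intros s; unfold envelope. assert (0 <= (s - t) ^ 2) by apply pow2_ge_0.
    apply Rplus_lt_0_compat; [apply Rinv_0_lt_compat; lra|].
    apply Rmult_lt_0_compat; [lra|apply exp_pos]. }
  assert (HqF : forall x z, 0 <= x <= / m -> - x <= Re z ->
     Cmod (expsum_laplace l z) <= 5 * (/ R * C0 * exp (x * t)) /\
     Cmod (expsum_laplace (expsum_deriv l) z) <= 5 * (C2 * C0 * exp (x * t))).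
  { intros x z Hx Hz; assert (X0 := exp_pos (x * t)).
    assert (Hex : forall s, 0 <= s -> exp (- (Re z * s)) <= exp (x * s))
      by (intros s Hs; apply exp_le_compat; nra).
    split; apply (expsum_laplace_envelope _ z m t); auto.
    - apply Rmult_le_pos; [apply Rmult_le_pos; lra|lra].
    - apply Hfreq1; lra.
    - intros s Hs. destruct (Hreal x s Hx Hs) as [H1 _]. 
      eapply Rle_trans; [|exact H1]. apply Rmult_le_compat_r; [apply Cmod_ge_0|auto].
    - apply Rmult_le_pos; [apply Rmult_le_pos; lra|lra].
    - intros p Hp; apply in_map_iff in Hp as (q & <- & Hq); exact (Hfreq1 z ltac:(lra) q Hq).
    - intros s Hs. destruct (Hreal x s Hx Hs) as [_ H1].
      eapply Rle_trans; [apply Rmult_le_compat_r; [apply Cmod_ge_0|apply Hex, Hs]|].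
      eapply Rle_trans; [exact H1|].
      apply Rmult_le_compat_r; [left; apply env_pos|].
      apply Rmult_le_compat_r; [lra|]. apply Rmult_le_compat_r; lra. }
  assert (Hbd : forall s, 0 <= s -> Cmod (expsum l (RtoC s)) <= C0 * (1 + i) /\
     Cmod (expsum (expsum_deriv l) (RtoC s)) <= P * (1 + i)).
  { intros s Hs. destruct (Hreal 0 s ltac:(lra) Hs) as [H1 H2].
    rewrite !Rmult_0_l, exp_0, !Rmult_1_l, Rmult_1_r in H1, H2.
    assert (E := envelope_le m m0 t s Hm0 Hm Hs). fold i in E. specialize (env_pos s).
    split; (eapply Rle_trans; [eassumption|]); apply Rmult_le_compat; try lra.
    - apply Rmult_le_pos; lra.
    - rewrite <- (Rmult_1_l C0) at 2. apply Rmult_le_compat_r; lra.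
    - assert (HnI := pos_INR n). apply Rmult_le_pos; [apply Rmult_le_pos; lra|lra].
    - unfold P; rewrite (Rmult_comm C0). apply Rmult_le_compat_r; lra. }
  assert (HzF : forall z, Omega M z ->
     Cmod (z * expsum_laplace l z)%C <= C0 * (1 + i) + Cmod (expsum_laplace (expsum_deriv l) z)).
  { intros z Hz.
    assert (E := expsum_laplace_deriv l z).
    lapply E; [clear E; intros E|intros p Hp Ep; apply (proj2 (HlO p Hp)); rewrite Ep; exact Hz].
    replace (z * expsum_laplace l z)%C with (expsum l 0 + expsum_laplace (expsum_deriv l) z)%C
      by (rewrite E; ring).
    eapply Rle_trans; [apply Cmod_triangle|]. apply Rplus_le_compat_r, (Hbd 0); lra. }
  assert (Hlup : freqs_in (fun mu => R + 1 <= Im mu) l) by (intros p Hp; apply (Hl p Hp)).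
  exists l; split; [exact HlO|split; [exact Hlt|split; [|split; [|split]]]].
  - intros s Hs; destruct (Hbd s Hs); unfold K; split; lra.
  - intros z Hz HzR.
    assert (Hzm : - / m <= Re z).
    { unfold Omega in Hz. assert (m <= M (Rabs (Im z))) by (apply M_incr; lra).
      assert (1 / M (Rabs (Im z)) <= / m); [|lra].
      unfold Rdiv; rewrite Rmult_1_l; apply Rinv_le_contravar; lra. }
    destruct (HqF (/ m) z ltac:(lra) Hzm) as [H1 H2].
    replace (/ m * t) with (t / m) in H1, H2 by (unfold Rdiv; ring).
    assert (Hq : 1 <= exp (t / m)).
    { rewrite <- exp_0; apply exp_le_compat, Rdiv_le_0_compat; lra. }
    set (q := exp (t / m)) in *. split.
    + eapply Rle_trans; [exact H1|]. unfold Rdiv.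
      replace (5 * (/ R * C0 * q)) with (5 * C0 * (q * / R)) by ring.
      apply Rmult_le_compat_r; [apply Rmult_le_pos; lra|]. unfold K; lra.
    + eapply Rle_trans; [apply HzF, Hz|].
      assert (C0 * (1 + i) * 1 <= C0 * (1 + i) * q) by (apply Rmult_le_compat_l; lra).
      assert (C0 * (1 + i) * q + 5 * (C2 * C0 * q) <= K * q); [|lra].
      replace (C0 * (1 + i) * q + 5 * (C2 * C0 * q)) with ((C0 * (1 + i) + 5 * P) * q)
        by (unfold P; ring).
      apply Rmult_le_compat_r; unfold K; lra.
  - intros z Hz HzR.
    assert (HF : Cmod (expsum_laplace l z) <= / R).
    { apply (expsum_laplace_upper_bound l z R); auto; [lra|].
      assert (Q := Rle_abs (Im z)); lra. }
    split; [unfold K; lra|].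
    destruct (Rle_dec 0 (Re z)) as [Hz0|Hz0].
    + destruct (HqF 0 z ltac:(lra) ltac:(lra)) as [_ H2].
      rewrite Rmult_0_l, exp_0, Rmult_1_r in H2.
      eapply Rle_trans; [apply HzF, Hz|]. replace (C2 * C0) with P in H2 by (unfold P; ring).
      unfold K; lra.
    + rewrite Cmod_mult.
      assert (Hzz : Cmod z <= R * (1 + i)).
      { eapply Rle_trans; [apply Cmod_le_abs|]. rewrite (Rabs_left (Re z)) by lra.
        unfold Omega in Hz. assert (m0 <= M (Rabs (Im z))) by (apply M_incr; [lra|apply Rabs_pos]).
        assert (1 / M (Rabs (Im z)) <= i).
        { unfold Rdiv, i; rewrite Rmult_1_l; apply Rinv_le_contravar; lra. }
        nra. }
      apply Rle_trans with (R * (1 + i) * / R).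
      * apply Rmult_le_compat; try apply Cmod_ge_0; assumption.
      * replace (R * (1 + i) * / R) with (1 + i) by (field; lra). unfold K; lra.
  - intros z z' Hz Hz'.
    apply Rle_trans with (/ R * Cmod (z - z')%C).
    + apply (expsum_laplace_upper_lipschitz l z z' R); auto; [lra| |];
        [assert (Q := Rle_abs (Im z))|assert (Q := Rle_abs (Im z'))]; lra.
    + apply Rmult_le_compat_r; [apply Cmod_ge_0|]. unfold K; lra.
Qed.

(** With [c t = Mlog M R], the packets become test functions with constants that do
    not depend on [t] provided [e^(t / M(R))] is [O(R M(R))] for the weight [1], or
    [O(M(R))] for the weight [z]. *)
Lemma decay_rate_bound (M r : R -> R) (w : C -> C) (c B kappa R0 : R) :
  (forall s, 0 <= s -> 0 < M s) -> (forall s, 0 <= s -> 0 < r s) ->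
  nondecreasing_on_Rplus M -> continuous_on Rnonneg M -> 1 <= c -> 0 <= B -> 0 <= kappa ->
  (forall s, 0 <= s -> ln (1 + M s) <= B * (1 + s)) ->
  (forall R t, R0 <= R -> 1 <= R -> c * t = Mlog M R -> exp (t / M R) <= kappa * (R * M R)) ->
  (forall z, w z = 1%C) \/
  ((forall z, w z = z) /\
   forall R t, R0 <= R -> 1 <= R -> c * t = Mlog M R -> exp (t / M R) <= kappa * M R) ->
  (forall f : R -> C, bounded_on_Rplus f -> lipschitz_on_Rplus f ->
     has_uniformly_continuous_derivative f ->
     (exists F, laplace_extends_to M f F /\
        exists k, forall z, Omega M z -> Cmod (w z * F z)%C / M (Rabs (Im z)) <= k) ->
     bigO_infty (fun t => Cmod (f t)) (fun t => / r t)) ->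
  bigO_infty r (fun t => Mlog_inv M (c * t)).
Proof.
  intros M_pos r_pos M_incr M_cont Hc HB Hkappa HM Hq Hw Hdecay.
  destruct (wave_packet_transform M c B M_pos M_incr Hc HB HM) as [K [HK Hpacket]].
  set (m0 := M 0). assert (Hm0 : 0 < m0) by (apply M_pos; lra).
  assert (Hi : 0 < / m0) by (apply Rinv_0_lt_compat; lra).
  assert (HKi : 0 < K * / m0) by (apply Rmult_lt_0_compat; lra).
  assert (HKk : 0 <= K * kappa) by (apply Rmult_le_pos; lra).
  set (K' := K + K * / m0 + K * kappa).
  apply (gliding_hump M r _ w K'); auto; [unfold K'; lra|].
  intros L.
  set (R1 := Rmax 1 (Rmax R0 L)).
  assert (A1 : 1 <= R1) by apply Rmax_l.
  assert (A2 : R0 <= R1) by (eapply Rle_trans; [apply Rmax_l|apply Rmax_r]).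
  assert (A3 : L <= R1) by (eapply Rle_trans; [apply Rmax_r|apply Rmax_r]).
  exists (Rmax 3 (Mlog M R1)); intros t Ht.
  assert (B1 := Rle_trans _ _ _ (Rmax_l _ _) Ht).
  assert (B2 := Rle_trans _ _ _ (Rmax_r _ _) Ht).
  assert (B3 : Mlog M R1 <= c * t) by nra.
  destruct (Mlog_inv_spec M M_pos M_incr M_cont (c * t)) as [HR HRt].
  { left; eapply Rlt_le_trans; [apply (Mlog_strict M M_pos M_incr 0 R1); lra|exact B3]. }
  set (R := Mlog_inv M (c * t)) in *.
  assert (HRR : R1 <= R).
  { apply Rnot_lt_le; intros Hlt.
    assert (Q := Mlog_strict M M_pos M_incr _ _ HR Hlt). lra. }
  destruct (Hpacket t R B1 ltac:(lra) ltac:(symmetry; exact HRt))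
    as (l & Hl & Hlt & Hbd & Hhigh & Hlow & Hlip).
  assert (HMz : forall z, m0 <= M (Rabs (Im z))) by (intros z; apply M_incr; [lra|apply Rabs_pos]).
  assert (HK'M : forall z y, y <= K -> y <= K' * M (Rabs (Im z))).
  { intros z y Hy; specialize (HMz z).
    apply Rle_trans with (K * / m0 * m0); [rewrite Rmult_assoc, Rinv_l; lra|].
    unfold K'; apply Rmult_le_compat; lra. }
  assert (HkM : forall z y q, R <= Rabs (Im z) -> y <= K * q -> q <= kappa * M R ->
     y <= K' * M (Rabs (Im z))).
  { intros z y q Hz Hy Hqq.
    assert (Hmz : M R <= M (Rabs (Im z))) by (apply M_incr; lra).
    assert (HmR := M_pos R ltac:(lra)).
    apply Rle_trans with (K * kappa * M R).
    - rewrite Rmult_assoc. eapply Rle_trans; [exact Hy|]. apply Rmult_le_compat_l; lra.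
    - unfold K'; apply Rmult_le_compat; lra. }
  assert (Growth : forall z, Omega M z -> Cmod (expsum_laplace l z) <= K' * M (Rabs (Im z))).
  { intros z Hz; destruct (Rle_lt_dec R (Rabs (Im z))) as [h|h].
    - apply (HkM z _ _ h (proj1 (Hhigh z Hz h))).
      specialize (Hq R t ltac:(lra) ltac:(lra) ltac:(symmetry; exact HRt)).
      apply Rmult_le_reg_r with R; [lra|].
      unfold Rdiv; rewrite Rmult_assoc, Rinv_l by lra. lra.
    - apply HK'M, Hlow; assumption. }
  exists (fun s => expsum l (RtoC s)), (fun s => expsum (expsum_deriv l) (RtoC s)), (expsum_laplace l).
  split; [|rewrite Hlt, Rinv_l; lra].
  assert (HKK : K <= K') by (unfold K'; lra).
  split.
  - intros s Hs; eapply Rle_trans; [apply Hbd, Hs|exact HKK].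
  - intros s; apply is_derive_RC_expsum.
  - intros s Hs; eapply Rle_trans; [apply Hbd, Hs|exact HKK].
  - apply expsum_lipschitz. intros p Hp; apply in_map_iff in Hp as (q & <- & Hq').
    destruct (Hl q Hq') as [H1 _]; simpl; lra.
  - intros z Hz; apply expsum_laplace_analytic.
    intros p Hp E; apply (proj2 (Hl p Hp)); rewrite E; exact Hz.
  - intros z Hz; apply laplace_expsum.
    intros p Hp; destruct (Hl p Hp) as [H1 _]; lra.
  - exact Growth.
  - intros z Hz; destruct Hw as [Hw|[Hw Hq2]]; rewrite Hw.
    + rewrite Cmult_1_l; apply Growth, Hz.
    + destruct (Rle_lt_dec R (Rabs (Im z))) as [h|h].
      * apply (HkM z _ _ h (proj2 (Hhigh z Hz h))).
        apply Hq2; try lra.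
      * apply HK'M, Hlow; assumption.
  - intros z z' Hz Hz'. eapply Rle_trans; [apply Hlip; lra|].
    apply Rmult_le_compat_r; [apply Cmod_ge_0|exact HKK].
Qed.

(** * The two growth conditions *)

Lemma ln_growth (M : R -> R) : (forall s, 0 <= s -> 0 < M s) -> nondecreasing_on_Rplus M ->
  (exists alpha, 0 < alpha /\ bigO_infty M (fun s => exp (alpha * s))) ->
  exists B, 0 <= B /\ forall s, 0 <= s -> ln (1 + M s) <= B * (1 + s).
Proof.
  intros M_pos M_incr [alpha [Ha [K [T HT]]]].
  set (T' := Rabs T). assert (HT' := Rle_abs T). assert (T0 := Rabs_pos T). fold T' in HT', T0.
  set (X := 1 + Rabs K * exp (alpha * T')).
  assert (HX : 1 <= X).
  { unfold X. assert (0 <= Rabs K * exp (alpha * T')); [|lra].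
    apply Rmult_le_pos; [apply Rabs_pos|left; apply exp_pos]. }
  assert (HlX : 0 <= ln X).
  { rewrite <- ln_1. destruct HX as [HX|<-]; [left; apply ln_increasing; lra|apply Rle_refl]. }
  exists (ln X + alpha); split; [lra|]; intros s Hs.
  assert (H : M s <= Rabs K * (exp (alpha * T') * exp (alpha * s))).
  { apply Rle_trans with (M (s + T')); [apply M_incr; lra|].
    specialize (HT (s + T') ltac:(lra)).
    rewrite (Rabs_pos_eq (M _)) in HT by (left; apply M_pos; lra).
    rewrite (Rabs_pos_eq (exp _)) in HT by (left; apply exp_pos).
    rewrite <- exp_plus. replace (alpha * T' + alpha * s) with (alpha * (s + T')) by ring.
    eapply Rle_trans; [exact HT|]. apply Rmult_le_compat_r; [left; apply exp_pos|apply Rle_abs]. }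
  assert (E1 : 1 <= exp (alpha * s)).
  { rewrite <- exp_0 at 1; apply exp_le_compat. apply Rmult_le_pos; lra. }
  assert (H2 : 1 + M s <= X * exp (alpha * s)) by (unfold X; lra).
  apply Rle_trans with (ln (X * exp (alpha * s))).
  - assert (P := M_pos s Hs). destruct H2 as [H2|H2]; [left; apply ln_increasing; lra|rewrite H2; apply Rle_refl].
  - rewrite ln_mult, ln_exp by (try apply exp_pos; lra).
    assert (0 <= ln X * s) by (apply Rmult_le_pos; lra). lra.
Qed.

Lemma ln_one_plus_le (m m0 : R) : 0 < m0 -> m0 <= m -> ln (1 + m) <= ln m + ln (1 + / m0).
Proof.
  intros H0 Hm. assert (0 < / m0) by (apply Rinv_0_lt_compat; lra).
  rewrite <- ln_mult by lra.
  assert (E : 1 + m <= m * (1 + / m0)).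
  { assert (1 <= m * / m0); [|lra]. apply Rmult_le_reg_r with m0; [lra|].
    rewrite Rmult_assoc, Rinv_l; lra. }
  destruct E as [E|E]; [left; apply ln_increasing; lra|rewrite E; apply Rle_refl].
Qed.

(** The constant [c = 1 + 1/beta] is the one for which [R^beta = O(M(R))] turns
    [((1 + R) (1 + M(R)))^(1/c)] into [O(M(R))]. *)
Lemma exp_quotient_polynomial_growth (M : R -> R) (b beta s0 : R) :
  (forall s, 0 <= s -> 0 < M s) -> nondecreasing_on_Rplus M -> 0 < b -> 0 < beta ->
  (forall s, s0 <= s -> b * Rpower s beta <= M s) ->
  exists kappa, 0 <= kappa /\ forall R t, s0 <= R -> 1 <= R ->
    (1 + / beta) * t = Mlog M R -> exp (t / M R) <= kappa * M R.
Proof.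
  intros M_pos M_incr Hb Hbeta HM.
  set (m0 := M 0). assert (Hm0 : 0 < m0) by (apply M_pos; lra).
  set (c := 1 + / beta). assert (Hib : 0 < / beta) by (apply Rinv_0_lt_compat; lra).
  assert (Hc : 1 < c) by (unfold c; lra).
  set (X := ln 2 - / beta * ln b + ln (1 + / m0)).
  exists (exp (X / c)); split; [left; apply exp_pos|]; intros R t HR HR1 Hct.
  set (m := M R) in *. assert (Hm : m0 <= m) by (apply M_incr; lra).
  assert (Hmp : 0 < m) by lra.
  assert (Hlnm : ln b + beta * ln R <= ln m).
  { specialize (HM R HR). unfold Rpower in HM. fold m in HM.
    rewrite <- (ln_exp (beta * ln R)), <- ln_mult by (try apply exp_pos; lra).
    assert (0 < b * exp (beta * ln R)) by (apply Rmult_lt_0_compat; [lra|apply exp_pos]).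
    destruct HM as [HM|HM]; [left; apply ln_increasing; lra|rewrite HM; apply Rle_refl]. }
  assert (HlnR : ln (1 + R) <= ln 2 + ln R).
  { rewrite <- ln_mult by lra. 
    destruct (Rle_lt_or_eq_dec (1 + R) (2 * R)) as [E|E];
      [lra|left; apply ln_increasing; lra|rewrite E; apply Rle_refl]. }
  assert (HlnR2 : ln R <= / beta * (ln m - ln b)).
  { apply Rmult_le_reg_l with beta; [lra|]. rewrite <- Rmult_assoc, Rinv_r by lra. lra. }
  assert (Hlm := ln_one_plus_le m m0 Hm0 Hm).
  rewrite <- (exp_ln m Hmp) at 2. rewrite <- exp_plus. apply exp_le_compat.
  apply Rmult_le_reg_l with c; [lra|].
  replace (c * (X / c + ln m)) with (X + c * ln m) by (field; lra).
  replace (c * (t / m)) with (ln (1 + R) + ln (1 + m)).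
  - unfold X, c. lra.
  - replace (c * (t / m)) with (c * t / m) by (field; lra). rewrite Hct; unfold Mlog; fold m. field; lra.
Qed.

Theorem theorem2p2 :
  forall M r : R -> R,
    (forall s, 0 <= s -> 0 < M s) ->
    (forall s, 0 <= s -> 0 < r s) ->
    nondecreasing_on_Rplus M ->
    nondecreasing_on_Rplus r ->
    continuous_on Rnonneg M ->
    (exists alpha : R, 0 < alpha /\ bigO_infty M (fun s => exp (alpha * s))) ->
    ((forall f : R -> C,
        bounded_on_Rplus f ->
        lipschitz_on_Rplus f ->
        (exists F : C -> C,
           laplace_extends_to M f F /\
           exists K : R, forall z : C, Omega M z ->
             Cmod (F z) / M (Rabs (Im z)) <= K) ->
        bigO_infty (fun t => Cmod (f t)) (fun t => / r t)) ->
     bigO_infty r (Mlog_inv M))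
    /\
    (forall b beta : R,
       0 < b -> 0 < beta ->
       (exists s0 : R, 0 < s0 /\ forall s, s0 <= s -> b * Rpower s beta <= M s) ->
       (forall f : R -> C,
          bounded_on_Rplus f ->
          lipschitz_on_Rplus f ->
          has_uniformly_continuous_derivative f ->
          (exists F : C -> C,
             laplace_extends_to M f F /\
             exists K : R, forall z : C, Omega M z ->
               Cmod (z * F z)%C / M (Rabs (Im z)) <= K) ->
          bigO_infty (fun t => Cmod (f t)) (fun t => / r t)) ->
       bigO_infty r (fun t => Mlog_inv M ((1 + / beta) * t))).
Proof.
  intros M r M_pos r_pos M_incr r_incr M_cont M_exp.
  destruct (ln_growth M M_pos M_incr M_exp) as [B [HB HBM]].
  split.
  - intros Hdecay.
    assert (H : bigO_infty r (fun t => Mlog_inv M (1 * t))).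
    { assert (Hm0 := M_pos 0 (Rle_refl 0)).
      assert (Hi : 0 < / M 0) by (apply Rinv_0_lt_compat; lra).
      apply (decay_rate_bound M r (fun _ => 1%C) 1 B (2 * (1 + / M 0)) 1); auto; try lra.
      - intros R t _ HR Hct.
        assert (Hm := M_pos R ltac:(lra)).
        assert (Hmm : M 0 <= M R) by (apply M_incr; lra).
        replace (t / M R) with (1 * t / M R) by (field; lra).
        rewrite (Mlog_quotient M 1 t R Hm ltac:(lra) Hct).
        assert (E : 1 <= M R * / M 0).
        { apply Rmult_le_reg_r with (M 0); [lra|]. rewrite Rmult_assoc, Rinv_l; lra. }
        replace (2 * (1 + / M 0) * (R * M R)) with ((2 * R) * (M R + M R * / M 0)) by ring.
        apply Rmult_le_compat; lra.
      - intros f Hb Hl _ [F [HF [k Hk]]]; apply Hdecay; [exact Hb|exact Hl|].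
        exists F; split; [exact HF|]; exists k; intros z Hz.
        specialize (Hk z Hz); rewrite Cmult_1_l in Hk; exact Hk. }
    destruct H as [K [T HT]]; exists K, T; intros t Ht; specialize (HT t Ht).
    rewrite Rmult_1_l in HT; exact HT.
  - intros b beta Hb Hbeta [s0 [_ Hs0]] Hdecay.
    destruct (exp_quotient_polynomial_growth M b beta s0 M_pos M_incr Hb Hbeta Hs0)
      as [kappa [Hk Hq]].
    assert (Hib : 0 < / beta) by (apply Rinv_0_lt_compat; lra).
    apply (decay_rate_bound M r (fun z => z) (1 + / beta) B kappa s0); auto; try lra.
    intros R t H0 H1 Hct. eapply Rle_trans; [apply (Hq R t H0 H1 Hct)|].
    apply Rmult_le_compat_l; [exact Hk|].
    assert (Hm := M_pos R ltac:(lra)). nra.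
Qed.
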